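(* Let $\varepsilon\in(0,1]$, let $z_j^0\in t y_j-(t-1)\,\mathrm{conv}(X)$ for all $1\le j\le N$, and suppose $0<\tau\le K\varepsilon$, where $K>0$ is a constant depending only on $t$, $|b|_\infty$ and $D$ such that $\tau\le K\varepsilon$ implies $\tau\le\min\left(\frac{t(t-1)}{|b|_\infty},\frac{1}{L_Z}\right)$. Then the iterations (I1)–(I3) given in the context converge with linear rate: there exists $0<\eta<1$ such that $$f(x^{n+1})-f(x^* )\le\eta\,\bigl(f(x^n)-f(x^* )\bigr)\qquad\forall\,n\ge0,$$ where $x^*$ is the unique solution of $\min_{\phi,\psi,Z}f(\phi,\psi,Z)$ (with normalization $\phi_M=0$).
   Context: Data: $t>1$; points $X=(x_i)_{i=1}^M$, $Y=(y_j)_{j=1}^N$ in $\mathbb{R}^d$; weights $a_i>0$, $b_j>0$ with $\sum_ia_i=\sum_jb_j=1$; $D=\max_{i,j}|x_i-y_j|$; $|b|_\infty=\max_jb_j$; $\mathrm{conv}(X)$ is the convex hull of the points $x_i$, and $ty_j-(t-1)\mathrm{conv}(X)=\{ty_j-(t-1)x: x\in\mathrm{conv}(X)\}$. For $\phi\in\mathbb{R}^M$, $\psi\in\mathbb{R}^N$, $Z=(z_j)_{j=1}^N\subset\mathbb{R}^d$, set $C^t_{ij}(Z)=\frac1{2t}|z_j-x_i|^2$ and $$f(\phi,\psi,Z)=\varepsilon\sum_{i,j}a_ib_j\left[\exp\left(\frac{-C^t_{ij}(Z)+\phi_i+\psi_j}{\varepsilon}\right)-\frac{\phi_i+\psi_j}{\varepsilon}\right]+\frac{1}{2(t-1)}\sum_j|z_j-y_j|^2b_j.$$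 Since $f$ is invariant under $(\phi,\psi)\mapsto(\phi+c,\psi-c)$, $c\in\mathbb{R}$, the constant is fixed by imposing $\phi_M=0$ (and $\phi^n_M=0$ for all $n\ge0$). Iterations, for a step size $\tau>0$, starting from $x^0=(\phi^0,\psi^0,Z^0)$ (with $\phi^0_M=0$): (I1) $\phi_i^{n+1}=-\varepsilon\log\sum_{j=1}^Nb_j\exp\left(\frac{-C^t_{ij}(Z^n)+\psi_j^n}{\varepsilon}\right)$ for $1\le i\le M-1$, and $\phi_M^{n+1}=0$; (I2) $\psi_j^{n+1}=-\varepsilon\log\sum_{i=1}^Ma_i\exp\left(\frac{-C^t_{ij}(Z^n)+\phi_i^{n+1}}{\varepsilon}\right)$ for $1\le j\le N$; (I3) $z_j^{n+1}=z_j^n-\tau\left[\frac{z_j^n-y_j}{t-1}b_j-\sum_{i=1}^M\frac{z_j^n-x_i}{t}a_ib_j\exp\left(\frac{-C^t_{ij}(Z^n)+\phi_i^{n+1}+\psi_j^{n+1}}{\varepsilon}\right)\right]$ for $1\le j\le N$. Write $x^n=(\phi^n,\psi^n,Z^n)$ and $x^{n+\frac23}=(\phi^{n+1},\psi^{n+1},Z^n)$. Define $$L_Z=\sup_{n\ge0}\max_{s\in[0,1]}\max_{|h_Z|_2=1}\nabla_Z^2f\bigl((1-s)x^{n+\frac23}+sx^{n+1}\bigr)h_Z\cdot h_Z.$$ A constant $K$ as in the claim exists. *)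

(* Defs.v *)
From mathcomp Require Export all_boot all_order all_algebra.
From mathcomp Require Export all_classical all_reals all_analysis.
Export Order.TTheory GRing.Theory Num.Theory numFieldNormedType.Exports.

Set Implicit Arguments.
Unset Strict Implicit.
Unset Printing Implicit Defensive.

Local Open Scope classical_set_scope.
Local Open Scope ring_scope.

(* Point clouds are stored as matrices, one point of R^d per row.  The library
   norm on matrices is the sup norm, so the Euclidean one is written out. *)
Definition enorm (R : realType) m n (A : 'M[R]_(m, n)) : R :=
  Num.sqrt (\sum_i \sum_j A i j ^+ 2).

Definition conv_hull (R : realType) M d (X : 'M[R]_(M, d)) : set 'rV[R]_d :=
  [set x | exists w : 'I_M -> R,
     [/\ forall i, 0 <= w i, \sum_i w i = 1 & x = \sum_i w i *: row i X]].

Record problem (R : realType) (d M N : nat) := Problem {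
  ptX : 'M[R]_(M, d);
  ptY : 'M[R]_(N, d);
  wa : 'I_M -> R;
  wb : 'I_N -> R;
  tt_ : R;
  eps : R }.

(* (phi, psi, Z) *)
Definition state (R : realType) (d M N : nat) : Type :=
  ('rV[R]_M * 'rV[R]_N * 'M[R]_(N, d))%type.

Section Problem.
Context (R : realType) (d M N : nat) (P : problem R d M N).
Local Notation X := (ptX P).
Local Notation Y := (ptY P).
Local Notation a := (wa P).
Local Notation b := (wb P).
Local Notation t := (tt_ P).
Local Notation eps := (eps P).

Definition bmax : R := \big[Num.max/0]_j b j.

Definition diam : R :=
  \big[Num.max/0]_i \big[Num.max/0]_j enorm (row i X - row j Y).

Definition cost (Z : 'M[R]_(N, d)) (i : 'I_M) (j : 'I_N) : R :=
  (2 * t)^-1 * enorm (row j Z - row i X) ^+ 2.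

Definition gibbs (phi : 'rV[R]_M) (psi : 'rV[R]_N) (Z : 'M[R]_(N, d))
    (i : 'I_M) (j : 'I_N) : R :=
  expR ((- cost Z i j + phi 0 i + psi 0 j) / eps).

Definition objective (x : state R d M N) : R :=
  let: (phi, psi, Z) := x in
  eps * (\sum_i \sum_j a i * b j *
           (gibbs phi psi Z i j - (phi 0 i + psi 0 j) / eps))
  + (2 * (t - 1))^-1 * \sum_j enorm (row j Z - row j Y) ^+ 2 * b j.

(* The last coordinate of phi vanishes; indices start at 0, so it is the one
   with i.+1 = M. *)
Definition normalized (x : state R d M N) : Prop :=
  forall i : 'I_M, i.+1 = M -> x.1.1 0 i = 0.

Definition is_solution (x : state R d M N) : Prop :=
  normalized x /\ forall y, objective x <= objective y.

Definition phi_step (psi : 'rV[R]_N) (Z : 'M[R]_(N, d)) : 'rV[R]_M :=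
  \row_i if i.+1 == M then 0
         else - eps * ln (\sum_j b j * expR ((- cost Z i j + psi 0 j) / eps)).

Definition psi_step (phi : 'rV[R]_M) (Z : 'M[R]_(N, d)) : 'rV[R]_N :=
  \row_j (- eps * ln (\sum_i a i * expR ((- cost Z i j + phi 0 i) / eps))).

Definition Z_step (tau : R) (phi : 'rV[R]_M) (psi : 'rV[R]_N)
    (Z : 'M[R]_(N, d)) : 'M[R]_(N, d) :=
  \matrix_j (row j Z - tau *:
    ((b j / (t - 1)) *: (row j Z - row j Y)
     - \sum_i (a i * b j * gibbs phi psi Z i j / t) *: (row j Z - row i X))).

(* From x^n to x^(n+2/3): both potentials updated, Z unchanged. *)
Definition potential_step (x : state R d M N) : state R d M N :=
  let: (phi, psi, Z) := x in
  let phi' := phi_step psi Z in (phi', psi_step phi' Z, Z).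

Definition full_step (tau : R) (x : state R d M N) : state R d M N :=
  let: (phi', psi', Z) := potential_step x in
  (phi', psi', Z_step tau phi' psi' Z).

Definition iterate (tau : R) (x0 : state R d M N) (n : nat) : state R d M N :=
  iter n (full_step tau) x0.

(* Entries of the Hessian of the objective in Z, the variable Z being indexed
   by pairs (point, coordinate). *)
Definition hessZ (x : state R d M N) (p q : 'I_N * 'I_d) : R :=
  let g (Z : 'M[R]_(N, d)) : R := objective (x.1, Z) in
  'D_(delta_mx p.1 p.2 : 'M[R]_(N, d))
    (fun Z => 'D_(delta_mx q.1 q.2 : 'M[R]_(N, d)) g Z) x.2.

Definition hessZ_quad (x : state R d M N) (h : 'M[R]_(N, d)) : R :=
  \sum_p \sum_q hessZ x p q * h q.1 q.2 * h p.1 p.2.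

Definition LZ (tau : R) (x0 : state R d M N) : \bar R :=
  ereal_sup [set y : \bar R | exists n (s : R) (h : 'M[R]_(N, d)),
    [/\ 0 <= s <= 1, enorm h = 1 &
        y = (hessZ_quad ((1 - s) *: potential_step (iterate tau x0 n)
                         + s *: iterate tau x0 n.+1) h)%:E]].

Definition assumptions (x0 : state R d M N) : Prop :=
  [/\ (0 < d)%N, 1 < t & 0 < eps <= 1] /\
  [/\ forall i, 0 < a i, forall j, 0 < b j, \sum_i a i = 1 & \sum_j b j = 1] /\
  normalized x0 /\
  (forall j, exists2 x, conv_hull X x &
               row j x0.2 = t *: row j Y - (t - 1) *: x).

End Problem.

(* K may depend only on t, |b|_oo and D: it has to work for every problem, eps,
   step size and starting point with these three values.  In \bar R, the
   inverse of +oo is 0. *)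
Definition admissible (R : realType) (t beta D K : R) : Prop :=
  0 < K /\
  forall (d M N : nat) (P : problem R d M N) (x0 : state R d M N) (tau : R),
    tt_ P = t -> bmax P = beta -> diam P = D -> assumptions P x0 ->
    0 < tau <= K * eps P ->
    (tau%:E <= Order.min (t * (t - 1) / bmax P)%:E (LZ P tau x0)^-1)%E.

(* Main.v *)
Require Import Defs.
From mathcomp Require Import ring lra.

(** The objective [f] is not convex in [(phi, psi, Z)], but it is strictly convex
    in [(phi, psi - |z|^2/(2t), Z)]: there the exponents are affine, and the
    square of [z_j] is left with the coefficient [b_j / (2t(t-1))], positive
    since it is half of [b_j (1/(t-1) - 1/t)].  Everything rests on the exact
    form of this remark, the expansion [objective_expansion] of [f] at an
    arbitrary base point, whose remainder is a sum of nonnegative terms.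

    Completing squares ([objective_coerciveE]) shows that [f] is coercive on
    normalized states, whence a minimizer ([exists_solution]); the expansion at
    the midpoint of two minimizers, in the convex coordinates, gives uniqueness
    ([unique_solution]).

    For the rate, coercivity bounds the exponents on the sublevel set of the
    starting point, where the iterations stay.  On that set the remainder of the
    expansion dominates a definite quadratic form, so that [f - min f] is at most
    a constant times the squared gradient ([gradient_domination]).  The gradient
    is evaluated after the two potential updates, where its [psi] part vanishes.
    Its [phi] part was zero just before the update of [psi], and what this
    update adds to it is bounded by the decrease of [f]
    ([potential_step_decrease]); the [Z] part is bounded by the decrease of [f]
    along the gradient step, by the descent lemma for a step [tau <= 1/L_Z]
    ([Z_step_decrease]).  So [f(x^{n+1}) - min f] is at most a constant times
    [f(x^n) - f(x^{n+1})], which is linear convergence ([linear_rate]).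

    For the existence of [K], the gradient step is a convex combination of [z_j]
    and a point of [t y_j - (t-1) conv(X)], so the [z_j] stay within distance
    [t D] of the points of [X].  A step [tau <= K eps] then changes the exponents
    by a bounded amount ([logit_full_step]).  The Gibbs weights average to one
    after the update of [psi], so they average to at most [expR 1] along the
    step, and the Hessian in [Z] is at most a constant over [eps]
    ([hess_form_full_step_le]). *)

Set Implicit Arguments.
Unset Strict Implicit.
Unset Printing Implicit Defensive.

Local Open Scope ring_scope.

(** * Elementary inequalities *)

Section Elementary.
Local Open Scope classical_set_scope.
Local Open Scope ring_scope.
Context {R : realType}.

(** With [expR s = expR (s / 2) ^+ 2], the Taylor remainder is at least
    [(expR (s / 2) - 1) ^+ 2].  The denominator keeps the bound valid for
    all [s], although the remainder grows only linearly at minus infinity. *)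
Lemma expR_quad_lower (s : R) : (s / (2 + `|s|)) ^+ 2 <= expR s - 1 - s.
Proof.
have sq : expR s = expR (s / 2) ^+ 2 by rewrite expr2 -expRD -splitr.
have h1 : (expR (s / 2) - 1) ^+ 2 <= expR s - 1 - s.
  have := expR_ge1Dx (s / 2); rewrite sq; nra.
apply: le_trans h1; rewrite -ler_sqrt ?sqr_ge0// !sqrtr_sqr.
have n0 := normr_ge0 s.
rewrite normrM normfV (ger0_norm (_ : 0 <= 2 + `|s|)); last by lra.
rewrite ler_pdivrMr; last by lra.
have [s0|s0] := leP 0 s.
  have e1 := expR_ge1Dx (s / 2).
  rewrite (ger0_norm s0) ger0_norm; last by lra.
  have : 0 <= (expR (s / 2) - 1 - s / 2) * (2 + s) by apply: mulr_ge0; lra.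
  nra.
have e1 : expR (s / 2) <= 1 by rewrite -[leRHS]expR0 ler_expR; lra.
have e2 := expR_ge1Dx (- (s / 2)).
have e3 : expR (- (s / 2)) * expR (s / 2) = 1 by rewrite -expRD addNr expR0.
have e4 := expR_gt0 (s / 2).
rewrite (ltr0_norm s0) ler0_norm; last by lra.
have : 0 <= (expR (- (s / 2)) - 1 + s / 2) * expR (s / 2).
  by apply: mulr_ge0; lra.
nra.
Qed.

Lemma expR_quad_lower_bounded (B s : R) : `|s| <= B ->
  s ^+ 2 / (2 + B) ^+ 2 <= expR s - 1 - s.
Proof.
move=> sB; apply: le_trans (expR_quad_lower s).
have n0 := normr_ge0 s.
rewrite expr_div_n ler_wpM2l ?sqr_ge0// lef_pV2 ?posrE ?exprn_gt0//; try lra.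
by rewrite ler_sqr ?nnegrE; lra.
Qed.

Lemma expR_subr1_sq_le (B s : R) : s <= B ->
  (expR s - 1) ^+ 2 <= 2 * (expR B + 1) * (expR s - 1 - s).
Proof.
move=> sB.
have sq : expR s = expR (s / 2) ^+ 2 by rewrite expr2 -expRD -splitr.
have eB : expR s <= expR B by rewrite ler_expR.
have e4 := expR_gt0 (s / 2).
have h1 : (expR (s / 2) - 1) ^+ 2 <= expR s - 1 - s.
  have := expR_ge1Dx (s / 2); rewrite sq; nra.
have h2 : (expR (s / 2) + 1) ^+ 2 <= 2 * (expR B + 1).
  by have := sqr_ge0 (expR (s / 2) - 1); rewrite sq in eB; nra.
have -> : (expR s - 1) ^+ 2 = (expR (s / 2) + 1) ^+ 2 * (expR (s / 2) - 1) ^+ 2.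
  by rewrite sq; ring.
by apply: ler_pM; rewrite ?sqr_ge0.
Qed.

Lemma expR_subr_ge_norm (p : R) : `|p| <= expR p - p.
Proof.
have [p0|p0] := leP 0 p; last first.
  by rewrite ltr0_norm//; have := expR_gt0 p; lra.
rewrite ger0_norm//.
have sq : expR p = expR (p / 2) ^+ 2 by rewrite expr2 -expRD -splitr.
have e1 : (1 + p / 2) ^+ 2 <= expR (p / 2) ^+ 2.
  by rewrite ler_sqr ?nnegrE ?expR_ge0 ?expR_ge1Dx//; lra.
by have := sqr_ge0 (1 - p / 2); rewrite sq; nra.
Qed.

Lemma mulr_ge_young (l g x : R) : 0 < l ->
  - (g ^+ 2 / (4 * l)) - l * x ^+ 2 <= g * x.
Proof.
move=> l0; rewrite -subr_ge0.
have -> : g * x - (- (g ^+ 2 / (4 * l)) - l * x ^+ 2)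
        = (g + 2 * l * x) ^+ 2 / (4 * l) by field; lra.
by rewrite divr_ge0 ?sqr_ge0//; lra.
Qed.

Lemma finite_bound (I : finType) (f : I -> R) :
  exists2 B : R, 0 <= B & forall i, f i <= B.
Proof.
exists (\sum_i `|f i|) => [|i]; first exact: sumr_ge0.
apply: le_trans (ler_norm _) _; rewrite (bigD1 i)//= lerDl.
exact: sumr_ge0.
Qed.

Lemma norm_le_sq (u : R) : `|u| <= 1 + u ^+ 2.
Proof. by rewrite -real_normK ?num_real//; have := sqr_ge0 (`|u| - 1); nra. Qed.

Lemma mean_sqr_le (I : finType) (w u : I -> R) : (forall i, 0 <= w i) ->
  \sum_i w i = 1 -> (\sum_i w i * u i) ^+ 2 <= \sum_i w i * u i ^+ 2.
Proof.
move=> w0 w1; have [m mE] : exists m, \sum_i w i * u i = m by eexists.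
rewrite mE; have : 0 <= \sum_i w i * (u i - m) ^+ 2.
  by apply: sumr_ge0 => i _; rewrite mulr_ge0 ?sqr_ge0.
have -> : \sum_i w i * (u i - m) ^+ 2 =
    \sum_i w i * u i ^+ 2 - 2 * m * \sum_i w i * u i + m ^+ 2 * \sum_i w i.
  rewrite !mulr_sumr -sumrB -big_split/=.
  by apply: eq_bigr => i _; ring.
by rewrite w1 mE expr2; lra.
Qed.

Lemma sum_weighted_expR_gt0 (I : finType) (w u : I -> R) :
  (forall i, 0 < w i) -> \sum_i w i = 1 -> 0 < \sum_i w i * expR (u i).
Proof.
move=> w0 w1.
have pos i : 0 <= w i * expR (u i) by rewrite mulr_ge0 ?expR_ge0// ltW.
rewrite lt_def sumr_ge0// andbT; apply/negP; rewrite psumr_eq0// => /allP h.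
have : \sum_i w i = 0.
  apply: big1 => i _; have := h i (mem_index_enum _).
  by rewrite /= mulf_eq0 (gt_eqF (w0 i)) (gt_eqF (expR_gt0 _)).
by rewrite w1 => /eqP; rewrite oner_eq0.
Qed.

Lemma cvg_sumr (I T : Type) (r : seq I) (F : set_system T) (f : I -> T -> R)
    (l : I -> R) : Filter F ->
  (forall i, f i v @[v --> F] --> l i) ->
  \sum_(i <- r) f i v @[v --> F] --> \sum_(i <- r) l i.
Proof.
move=> FF fl; elim: r => [|i r IH].
  by rewrite big_nil; under eq_fun do rewrite big_nil; exact: cvg_cst.
by rewrite big_cons; under eq_fun do rewrite big_cons; exact: cvgD.
Qed.

End Elementary.

(** * The Euclidean inner product of row vectors *)

Section Dot.
Context {R : realType} {d : nat}.
Implicit Types u v w : 'rV[R]_d.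

Definition dot u v : R := \sum_k u 0 k * v 0 k.

Lemma dotC u v : dot u v = dot v u.
Proof. by apply: eq_bigr => k _; rewrite mulrC. Qed.

Lemma dotDl u v w : dot (u + v) w = dot u w + dot v w.
Proof. by rewrite -big_split; apply: eq_bigr => k _; rewrite mxE mulrDl. Qed.

Lemma dotZl c u v : dot (c *: u) v = c * dot u v.
Proof. by rewrite mulr_sumr; apply: eq_bigr => k _; rewrite mxE mulrA. Qed.

Lemma dotNl u v : dot (- u) v = - dot u v.
Proof. by rewrite -scaleN1r dotZl mulN1r. Qed.

Lemma dotBl u v w : dot (u - v) w = dot u w - dot v w.
Proof. by rewrite dotDl dotNl. Qed.

Lemma dotDr u v w : dot w (u + v) = dot w u + dot w v.
Proof. by rewrite !(dotC w) dotDl. Qed.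

Lemma dotZr c u v : dot u (c *: v) = c * dot u v.
Proof. by rewrite !(dotC u) dotZl. Qed.

Lemma dotNr u v : dot u (- v) = - dot u v.
Proof. by rewrite !(dotC u) dotNl. Qed.

Lemma dotBr u v w : dot w (u - v) = dot w u - dot w v.
Proof. by rewrite !(dotC w) dotBl. Qed.

Lemma dot_suml I (r : seq I) (F : I -> 'rV[R]_d) v :
  dot (\sum_(i <- r) F i) v = \sum_(i <- r) dot (F i) v.
Proof.
by rewrite exchange_big/=; apply: eq_bigr => k _; rewrite summxE mulr_suml.
Qed.

Definition dotE := (dotDl, dotBl, dotNl, dotZl, dotDr, dotBr, dotNr, dotZr).

Lemma dot_ge0 u : 0 <= dot u u.
Proof. by apply: sumr_ge0 => k _; rewrite -expr2 sqr_ge0. Qed.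

Lemma dot_eq0 u : dot u u = 0 -> u = 0.
Proof.
move/eqP; rewrite psumr_eq0 => [/allP h|k _]; last by rewrite -expr2 sqr_ge0.
apply/rowP => k; rewrite mxE; apply/eqP.
by have := h k (mem_index_enum _); rewrite /= mulf_eq0 orbb.
Qed.

Lemma dot_cauchy_schwarz u v : dot u v ^+ 2 <= dot u u * dot v v.
Proof.
have [v0|v0] := eqVneq (dot v v) 0.
  rewrite v0 mulr0 (dot_eq0 v0) /dot big1 ?expr0n// => k _.
  by rewrite mxE mulr0.
have vp : 0 < dot v v by rewrite lt_def v0 dot_ge0.
have := dot_ge0 (dot v v *: u - dot u v *: v).
have -> : dot (dot v v *: u - dot u v *: v) (dot v v *: u - dot u v *: v) =
    dot v v * (dot u u * dot v v - dot u v ^+ 2).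
  by rewrite !dotE (dotC v u); ring.
by rewrite pmulr_rge0// subr_ge0.
Qed.

Lemma enorm_sq u : enorm u ^+ 2 = dot u u.
Proof.
rewrite /enorm sqr_sqrtr ?big_ord1//.
by apply: sumr_ge0 => k _; rewrite sqr_ge0.
Qed.

Lemma sq_coord_le_dot (u : 'rV[R]_d) k : u 0 k ^+ 2 <= dot u u.
Proof.
rewrite /dot (bigD1 k)//= expr2 lerDl sumr_ge0// => l _.
by rewrite -expr2 sqr_ge0.
Qed.

Lemma dot_ge_young (l : R) (g h : 'rV[R]_d) : 0 < l ->
  - (dot g g / (4 * l)) - l * dot h h <= dot g h.
Proof.
move=> l0; have := dot_ge0 (g + (2 * l) *: h); rewrite !dotE (dotC h g) => e.
rewrite -subr_ge0.
have -> : dot g h - (- (dot g g / (4 * l)) - l * dot h h) =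
    (dot g g + 2 * l * dot g h + 2 * l * (dot g h + 2 * l * dot h h)) / (4 * l).
  by field; rewrite gt_eqF.
by apply: divr_ge0; [move: e; lra | rewrite mulr_ge0// ltW].
Qed.

Lemma dot_mean_le (I : finType) (w : I -> R) (v : I -> 'rV[R]_d) m :
  (forall l, 0 <= w l) -> \sum_l w l = 1 -> \sum_l w l *: v l = m ->
  dot m m <= \sum_l w l * dot (v l) (v l).
Proof.
move=> w0 w1 mE.
have : 0 <= \sum_l w l * dot (v l - m) (v l - m).
  by apply: sumr_ge0 => l _; rewrite mulr_ge0 ?dot_ge0.
have -> : \sum_l w l * dot (v l - m) (v l - m) =
    \sum_l w l * dot (v l) (v l) - dot m m.
  transitivity (\sum_l (w l * dot (v l) (v l) - 2 * dot (w l *: v l) m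
      + w l * dot m m)).
    by apply: eq_bigr => l _; rewrite !dotE (dotC m (v l)); ring.
  by rewrite big_split/= sumrB -mulr_sumr -dot_suml mE -mulr_suml w1; ring.
by rewrite subr_ge0.
Qed.

Lemma dot_comb_le (k B : R) (u v : 'rV[R]_d) : 0 <= k ->
  dot u u <= B -> dot v v <= B -> dot (u + k *: v) (u + k *: v) <= (1 + k) ^+ 2 * B.
Proof.
move=> k0 uB vB; have := mulr_ge0 k0 (dot_ge0 (u - v)).
have := ler_wpM2l k0 vB; have := ler_wpM2l (mulr_ge0 k0 k0) vB.
have := ler_wpM2l k0 uB.
rewrite !dotE (dotC v u); nra.
Qed.

End Dot.

Section Rows.
Context {R : realType} {N d : nat}.

Lemma rowDZ (Z h : 'M[R]_(N, d)) s j : row j (Z + s *: h) = row j Z + s *: row j h.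
Proof. by apply/rowP => k; rewrite !mxE. Qed.

Lemma enorm_sq_rows (h : 'M[R]_(N, d)) :
  enorm h ^+ 2 = \sum_j dot (row j h) (row j h).
Proof.
rewrite /enorm sqr_sqrtr; last first.
  by apply: sumr_ge0 => j _; apply: sumr_ge0 => k _; rewrite sqr_ge0.
by apply: eq_bigr => j _; apply: eq_bigr => k _; rewrite !mxE.
Qed.

Lemma dot_row_sum_delta (u : 'rV[R]_d) j (h : 'M[R]_(N, d)) :
  \sum_(q : 'I_N * 'I_d) h q.1 q.2 * dot u (row j (delta_mx q.1 q.2)) =
  dot u (row j h).
Proof.
rewrite -(pair_bigA _ (fun k l => h k l * dot u (row j (delta_mx k l))))/=.
rewrite (bigD1 j)//= [X in _ + X]big1 ?addr0 => [|k kj]; last first.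
  apply: big1 => l _; rewrite /dot big1 ?mulr0// => m _.
  by rewrite !mxE eq_sym (negbTE kj) mulr0.
apply: eq_bigr => l _; rewrite /dot (bigD1 l)//= big1 => [|m ml].
  by rewrite !mxE !eqxx mulr1 addr0 mulrC.
by rewrite !mxE (negbTE ml) andbF mulr0.
Qed.

End Rows.

(** * Convex hulls *)

Section ConvHull.
Context {R : realType} {M d : nat} (X : 'M[R]_(M, d)).

Lemma conv_hull_convex u v s : 0 <= s <= 1 -> conv_hull X u -> conv_hull X v ->
  conv_hull X ((1 - s) *: u + s *: v).
Proof.
move=> /andP[s0 s1] [w [w0 w1 ->]] [w' [w'0 w'1 ->]].
exists (fun i => (1 - s) * w i + s * w' i); split=> [i||].
- by rewrite addr_ge0 ?mulr_ge0 ?subr_ge0.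
- by rewrite big_split/= -!mulr_sumr w1 w'1; ring.
- rewrite !scaler_sumr -big_split; apply: eq_bigr => i _.
  by rewrite !scalerA scalerDl.
Qed.

(** Balls are convex. *)
Lemma conv_hull_dist_le (B k : R) c u : conv_hull X u ->
  (forall l, dot (c - k *: row l X) (c - k *: row l X) <= B) ->
  dot (c - k *: u) (c - k *: u) <= B.
Proof.
move=> [w [w0 w1 uE]] hB.
pose v l := c - k *: row l X; pose m := c - k *: u.
have mE : \sum_l w l *: v l = m.
  rewrite /m uE scaler_sumr -[in RHS](scale1r c) -w1 scaler_suml -sumrB.
  by apply: eq_bigr => l _; apply/rowP => i; rewrite !mxE; ring.
apply: le_trans (dot_mean_le w0 w1 mE) _.
apply: (@le_trans _ _ (\sum_l w l * B)).
  by apply: ler_sum => l _; apply: ler_wpM2l => //; exact: hB.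
by rewrite -mulr_suml w1 mul1r.
Qed.

End ConvHull.

(** * Calculus along lines *)

Section Derivatives.
Local Open Scope classical_set_scope.
Local Open Scope ring_scope.
Context {R : realType}.

(** Reduces directional derivatives in a normed space to derivatives of
    functions of one real variable. *)
Lemma is_derive_line (V : normedModType R) (f : V -> R) (z v : V) (df : R) :
  is_derive (0 : R) 1 (fun s => f (z + s *: v)) df -> is_derive z v f df.
Proof.
pose g (s : R) := f (z + s *: v); rewrite -/g => -[dg gE].
have e : (fun s : R => s^-1 *: ((f \o shift z) (s *: v) - f z)) =
    (fun s : R => s^-1 *: ((g \o shift 0) (s *: (1 : R^o)) - g 0)).
  by apply/funext => s /=; rewrite /g scale0r !addr0 [s *: 1]mulr1 (addrC z).
have D : derivable f z v by rewrite /derivable e.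
by apply: DeriveDef => //; rewrite -gE /derive e.
Qed.

Lemma is_derive_quadratic (c0 c1 c2 s : R) :
  is_derive s 1 (fun s => c0 + c1 * s + c2 * s ^+ 2) (c1 + 2 * c2 * s).
Proof.
have -> : (fun s => c0 + c1 * s + c2 * s ^+ 2) =
    cst c0 + c1 *: id + c2 *: (id ^+ 2) :> (R -> R).
  by apply/funext => u; rewrite !fctE.
have did : is_derive s 1 id 1 by exact: is_derive_id.
have dc1 : is_derive s 1 (c1 *: id) (c1 *: 1) by exact: is_deriveZ.
have dX : is_derive s 1 (id ^+ 2) (2 * s).
  by apply: (is_derive_eq (is_deriveX 2 did)); rewrite /GRing.scale/=; ring.
have dc2 : is_derive s 1 (c2 *: id ^+ 2) (c2 *: (2 * s)) by exact: is_deriveZ.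
have h := is_deriveD (is_deriveD (is_derive_cst c0 s 1) dc1) dc2.
apply: (is_derive_eq h); rewrite /GRing.scale/=; ring.
Qed.

(** The shape taken by each summand of the objective, and of its gradient,
    along a line in [Z]: the exponents are quadratic in [z_j]. *)
Lemma is_derive_expR_quadratic (c0 c1 c2 m0 m1 d0 d1 d2 s : R) :
  is_derive s 1 (fun s => expR (c0 + c1 * s + c2 * s ^+ 2) * (m0 + m1 * s)
                          + (d0 + d1 * s + d2 * s ^+ 2))
    (expR (c0 + c1 * s + c2 * s ^+ 2)
       * ((c1 + 2 * c2 * s) * (m0 + m1 * s) + m1) + (d1 + 2 * d2 * s)).
Proof.
have hc := is_derive_quadratic c0 c1 c2 s.
have hd := is_derive_quadratic d0 d1 d2 s.
have hm := is_derive_quadratic m0 m1 0 s.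
have he := @is_derive1_comp _ expR _ s _ _ (is_derive_expR _) hc.
have h := is_deriveD (is_deriveM he hm) hd.
have -> : (fun s => expR (c0 + c1 * s + c2 * s ^+ 2) * (m0 + m1 * s)
             + (d0 + d1 * s + d2 * s ^+ 2)) =
    ((expR \o (fun s => c0 + c1 * s + c2 * s ^+ 2))
      * (fun s => m0 + m1 * s + 0 * s ^+ 2)
      + (fun s => d0 + d1 * s + d2 * s ^+ 2)).
  by apply/funext => u; rewrite !fctE /= mul0r addr0.
apply: (is_derive_eq h); rewrite /GRing.scale/=; ring.
Qed.

Lemma le_init_of_derive_le0 (f f1 : R -> R) (s : R) :
  (forall u : R, is_derive u 1 f (f1 u)) ->
  (forall u, 0 <= u <= 1 -> f1 u <= 0) -> 0 <= s <= 1 -> f s <= f 0.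
Proof.
move=> df f1_le0 /andP[s0 s1].
have dv u : derivable f u 1 by case: (df u).
apply: (@ler0_derive1_nincr _ f 0 1) => //.
- move=> u; rewrite in_itv/= => /andP[u0 u1].
  by rewrite derive1E derive_val f1_le0// !ltW.
- by apply: derivable_within_continuous.
Qed.

Lemma taylor2_upper (L : R) (g g1 g2 : R -> R) :
  (forall u : R, is_derive u 1 g (g1 u)) -> (forall u : R, is_derive u 1 g1 (g2 u)) ->
  (forall u, 0 <= u <= 1 -> g2 u <= L) -> g 1 <= g 0 + g1 0 + L / 2.
Proof.
move=> dg dg1 g2L.
have g1L u : 0 <= u <= 1 -> g1 u <= g1 0 + L * u.
  move=> u01; rewrite -lerBlDr.
  have := @le_init_of_derive_le0 (fun v => g1 v - L * v) (fun v => g2 v - L) u.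
  rewrite mulr0 subr0; apply => // v; last by move=> /g2L; rewrite subr_le0.
  have h := is_deriveB (dg1 v) (is_derive_quadratic 0 L 0 v).
  have -> : (fun v => g1 v - L * v) = g1 - (fun v => 0 + L * v + 0 * v ^+ 2).
    by apply/funext => w; rewrite !fctE mul0r addr0 add0r.
  by apply: is_derive_eq; ring.
have := @le_init_of_derive_le0 (fun v => g v - (0 + g1 0 * v + L / 2 * v ^+ 2))
  (fun v => g1 v - (g1 0 + 2 * (L / 2) * v)) 1.
rewrite !mulr0 !mulr1 expr1n expr0n/= mulr1 mulr0 !addr0 !add0r subr0.
suff h1 : (g 1 - (g1 0 + L / 2) <= g 0) -> g 1 <= g 0 + g1 0 + L / 2.
  move=> h; apply: h1; apply: h => // [v|v /g1L h|]; last by rewrite ler01 lexx.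
    exact: is_deriveB (dg v) (is_derive_quadratic 0 (g1 0) (L / 2) v).
  by have -> : 2 * (L / 2) = L by [field]; rewrite subr_le0.
by lra.
Qed.

End Derivatives.

(** * The objective as an average over pairs of points *)

(** The part of [assumptions] that concerns the data alone, so that the
    objective can be studied without reference to a starting point. *)
Definition regular_problem (R : realType) d M N (P : problem R d M N) : Prop :=
  [/\ 1 < tt_ P, 0 < eps P,
      (forall i, 0 < wa P i) /\ (forall j, 0 < wb P j),
      \sum_i wa P i = 1 & \sum_j wb P j = 1].

Section Objective.
Local Open Scope classical_set_scope.
Local Open Scope ring_scope.
Context {R : realType} {d M N : nat} (P : problem R d M N).
Hypothesis regP : regular_problem P.
Local Notation X := (ptX P).
Local Notation Y := (ptY P).
Local Notation a := (wa P).
Local Notation b := (wb P).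
Local Notation t := (tt_ P).
Local Notation eps := (eps P).
Implicit Types (x y : state R d M N) (F G : 'I_M -> 'I_N -> R).

Let t_gt1 : 1 < t. Proof. by case: regP. Qed.
Let eps_gt0 : 0 < eps. Proof. by case: regP. Qed.
Let a_gt0 i : 0 < a i. Proof. by case: regP => _ _ []. Qed.
Let b_gt0 j : 0 < b j. Proof. by case: regP => _ _ []. Qed.
Let a_sum : \sum_i a i = 1. Proof. by case: regP. Qed.
Let b_sum : \sum_j b j = 1. Proof. by case: regP. Qed.
Let eps_neq0 : eps != 0. Proof. by rewrite gt_eqF. Qed.
Let t_gt0 : 0 < t. Proof. by move: t_gt1; lra. Qed.
Let t_neq0 : t != 0. Proof. by rewrite gt_eqF. Qed.
Let t1_gt0 : 0 < t - 1. Proof. by rewrite subr_gt0. Qed.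
Let t1_neq0 : t - 1 != 0. Proof. by rewrite gt_eqF. Qed.

Definition avg F : R := \sum_i \sum_j a i * b j * F i j.

Lemma eq_avg F G : (forall i j, F i j = G i j) -> avg F = avg G.
Proof.
by move=> FG; apply: eq_bigr => i _; apply: eq_bigr => j _; rewrite FG.
Qed.

Lemma avgD F G : avg F + avg G = avg (fun i j => F i j + G i j).
Proof.
rewrite -big_split; apply: eq_bigr => i _; rewrite -big_split.
by apply: eq_bigr => j _; rewrite mulrDr.
Qed.

Lemma avgZ c F : c * avg F = avg (fun i j => c * F i j).
Proof.
rewrite mulr_sumr; apply: eq_bigr => i _; rewrite mulr_sumr.
by apply: eq_bigr => j _; rewrite mulrCA.
Qed.

Lemma avgB F G : avg F - avg G = avg (fun i j => F i j - G i j).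
Proof. by rewrite -mulN1r avgZ avgD; apply: eq_avg => i j; ring. Qed.

Lemma sum_avg_col (v : 'I_N -> R) : \sum_j b j * v j = avg (fun _ j => v j).
Proof.
rewrite /avg exchange_big; apply: eq_bigr => j _.
rewrite -{1}(mul1r (b j)) -a_sum mulr_suml mulr_suml.
by [].
Qed.

Lemma le_avg F G : (forall i j, F i j <= G i j) -> avg F <= avg G.
Proof.
move=> FG; apply: ler_sum => i _; apply: ler_sum => j _.
by rewrite ler_wpM2l// mulr_ge0 // ltW.
Qed.

Lemma avg_ge0 F : (forall i j, 0 <= F i j) -> 0 <= avg F.
Proof.
move=> F0; apply: sumr_ge0 => i _; apply: sumr_ge0 => j _.
by rewrite mulr_ge0// mulr_ge0 // ltW.
Qed.

Lemma avg_ge_term F i j : (forall i j, 0 <= F i j) ->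
  a i * b j * F i j <= avg F.
Proof.
move=> F0; have pos k l : 0 <= a k * b l * F k l.
  by rewrite mulr_ge0// mulr_ge0 // ltW.
rewrite /avg (bigD1 i)//= (bigD1 j)//= -addrA lerDl addr_ge0//.
  exact: sumr_ge0.
by apply: sumr_ge0 => k _; apply: sumr_ge0.
Qed.

(** The logarithm of the Gibbs density. *)
Definition logit x i j : R :=
  (- cost P x.2 i j + x.1.1 0 i + x.1.2 0 j) / eps.

Lemma costE (Z : 'M[R]_(N, d)) i j :
  cost P Z i j = (2 * t)^-1 * dot (row j Z - row i X) (row j Z - row i X).
Proof. by rewrite /cost enorm_sq. Qed.

Lemma objectiveE x : objective P x = avg (fun i j =>
  eps * expR (logit x i j) - x.1.1 0 i - x.1.2 0 j
  + (2 * (t - 1))^-1 * dot (row j x.2 - row j Y) (row j x.2 - row j Y)).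
Proof.
case: x => [[phi psi] Z] /=.
rewrite /objective -/(avg _) avgZ.
under [X in _ * X]eq_bigr do rewrite enorm_sq mulrC.
rewrite sum_avg_col// avgZ avgD; apply: eq_avg => i j.
rewrite -[gibbs P phi psi Z i j]/(expR (logit (phi, psi, Z) i j)).
by field; rewrite ?eps_neq0 ?t1_neq0.
Qed.

Definition grad_phi x i : R := a i * (\sum_j b j * expR (logit x i j) - 1).

Definition grad_psi x j : R := b j * (\sum_i a i * expR (logit x i j) - 1).

Definition grad_Z x j : 'rV[R]_d :=
  (b j / (t - 1)) *: (row j x.2 - row j Y)
  - \sum_i (a i * b j * expR (logit x i j) / t) *: (row j x.2 - row i X).

Lemma dot_grad_Z x (h : 'M[R]_(N, d)) :
  \sum_j dot (grad_Z x j) (row j h) = avg (fun i j =>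
    (t - 1)^-1 * dot (row j x.2 - row j Y) (row j h)
    - expR (logit x i j) / t * dot (row j x.2 - row i X) (row j h)).
Proof.
rewrite -avgB -sum_avg_col// [X in _ - X]exchange_big/= -sumrB.
apply: eq_bigr => j _.
rewrite /grad_Z [LHS]dotBl [in LHS]dotZl dot_suml mulrA; congr (_ - _).
by apply: eq_bigr => i _; rewrite dotZl; ring.
Qed.

Lemma logitB x y i j : eps * (logit y i j - logit x i j) =
  y.1.1 0 i - x.1.1 0 i
  + (y.1.2 0 j - x.1.2 0 j
     - (2 * t)^-1 * dot (row j (y.2 - x.2)) (row j (y.2 - x.2)))
  - t^-1 * dot (row j x.2 - row i X) (row j (y.2 - x.2)).
Proof.
rewrite /logit !costE.
have -> : row j y.2 = row j x.2 + row j (y.2 - x.2).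
  by apply/rowP => k; rewrite !mxE; ring.
rewrite (addrAC (row j x.2) (row j (y.2 - x.2)) (- row i X)).
move: (row j x.2 - row i X) (row j (y.2 - x.2)) => u v.
rewrite !dotE (dotC v u); field.
by rewrite ?t_neq0 ?t1_neq0.
Qed.

(** Although the objective is not convex in [(phi, psi, Z)], it is convex in
    [(phi, psi - |z|^2/(2t), Z)]: in these coordinates the exponents are affine
    and the squares left over have positive coefficients, multiples of
    [1/(t-1) - 1/t].  Written at a base point [x] in the original coordinates,
    the substitution only corrects the increment of [psi_j] by
    [|dz_j|^2/(2t)], and gives an exact expansion whose remainder is a sum of
    nonnegative terms. *)
Lemma objective_expansion x y : objective P y - objective P x =
  \sum_i grad_phi x i * (y.1.1 0 i - x.1.1 0 i)
  + \sum_j grad_psi x j * (y.1.2 0 j - x.1.2 0 j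
      - (2 * t)^-1 * dot (row j (y.2 - x.2)) (row j (y.2 - x.2)))
  + \sum_j dot (grad_Z x j) (row j (y.2 - x.2))
  + avg (fun i j =>
      (2 * t * (t - 1))^-1 * dot (row j (y.2 - x.2)) (row j (y.2 - x.2))
      + eps * expR (logit x i j) *
        (expR (logit y i j - logit x i j) - 1
         - (logit y i j - logit x i j))).
Proof.
have -> : \sum_i grad_phi x i * (y.1.1 0 i - x.1.1 0 i) =
    avg (fun i j => (expR (logit x i j) - 1) * (y.1.1 0 i - x.1.1 0 i)).
  apply: eq_bigr => i _; rewrite /grad_phi -{1}b_sum -sumrB mulr_sumr mulr_suml.
  by apply: eq_bigr => j _; ring.
have -> : \sum_j grad_psi x j * (y.1.2 0 j - x.1.2 0 j
      - (2 * t)^-1 * dot (row j (y.2 - x.2)) (row j (y.2 - x.2))) =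
    avg (fun i j => (expR (logit x i j) - 1) * (y.1.2 0 j - x.1.2 0 j
      - (2 * t)^-1 * dot (row j (y.2 - x.2)) (row j (y.2 - x.2)))).
  rewrite /avg exchange_big; apply: eq_bigr => j _.
  rewrite /grad_psi -{1}a_sum -sumrB mulr_sumr mulr_suml.
  by apply: eq_bigr => i _; ring.
rewrite dot_grad_Z !objectiveE avgB !avgD; apply: eq_avg => i j /=.
have e : expR (logit y i j) = expR (logit x i j) * expR (logit y i j - logit x i j).
  by rewrite -expRD; congr expR; ring.
have := logitB x y i j; rewrite {}e.
move: (expR (logit y i j - logit x i j)) (expR (logit x i j)) (logit y i j - _) => E1 E2 s.
have -> : row j y.2 = row j x.2 + row j (y.2 - x.2).
  by apply/rowP => k; rewrite !mxE; ring.
rewrite (addrAC (row j x.2) (row j (y.2 - x.2)) (- row j Y)).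
move: (row j x.2 - row i X) (row j (y.2 - x.2)) (row j x.2 - row j Y) => u v w.
rewrite !dotE (dotC v w) => h.
have -> : forall A, eps * E2 * (A - s) = eps * E2 * A - E2 * (eps * s).
  by move=> A; ring.
rewrite h; field.
by rewrite ?t_neq0 ?t1_neq0.
Qed.

Lemma expansion_remainder_ge0 x y i j : 0 <= eps * expR (logit x i j) *
  (expR (logit y i j - logit x i j) - 1 - (logit y i j - logit x i j)).
Proof.
apply: mulr_ge0; first by rewrite mulr_ge0 ?expR_ge0// ltW.
by apply: le_trans (expR_quad_lower _); exact: sqr_ge0.
Qed.

(** Completing the square in each [z_j] turns the difference of the two
    quadratic costs into a square centred at [t y_j - (t-1) x_i], up to a
    constant; the remaining terms are all bounded below, which is where the
    coercivity of the objective comes from. *)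
Lemma objective_coerciveE x : objective P x = avg (fun i j =>
  eps * (expR (logit x i j) - logit x i j)
  + (2 * t * (t - 1))^-1
    * dot (row j x.2 - (t *: row j Y - (t - 1) *: row i X))
          (row j x.2 - (t *: row j Y - (t - 1) *: row i X))
  - 2^-1 * dot (row i X - row j Y) (row i X - row j Y)).
Proof.
rewrite objectiveE; apply: eq_avg => i j.
have -> : eps * (expR (logit x i j) - logit x i j) =
    eps * expR (logit x i j) + cost P x.2 i j - x.1.1 0 i - x.1.2 0 j.
  by rewrite {2}/logit; field; rewrite eps_neq0.
rewrite costE; move: (row j x.2) (row i X) (row j Y) => z u v.
rewrite !dotE (dotC u z) (dotC v z) (dotC v u); field.
by rewrite ?t_neq0 ?t1_neq0.
Qed.

(** * Existence and uniqueness of the minimizer *)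

Lemma last_index : exists i : 'I_M, i.+1 = M.
Proof.
case: M a a_sum => [a0|m _ _].
  by rewrite big_ord0 => /eqP; rewrite eq_sym oner_eq0.
by exists ord_max.
Qed.

Lemma row_index : exists j : 'I_N, True.
Proof.
case: N b b_sum => [b0|n _ _].
  by rewrite big_ord0 => /eqP; rewrite eq_sym oner_eq0.
by exists ord0.
Qed.

(** The summands of [objective_coerciveE] are bounded below and their weights are
    positive, so a bound on the average bounds each of them. *)
Lemma sublevel_bounded c : exists2 B, 0 <= B & forall x, objective P x <= c ->
  (forall i j, `|logit x i j| <= B) /\ (forall j k, `|x.2 j k| <= B).
Proof.
pose A := c + avg (fun i j =>
  2^-1 * dot (row i X - row j Y) (row i X - row j Y)).
have [B1 B1_0 B1P] := finite_bound (fun p : 'I_M * 'I_N =>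
  `|A| / (a p.1 * b p.2) / eps).
have [B2 B2_0 B2P] := finite_bound (fun p : 'I_M * 'I_N =>
  `|A| / (a p.1 * b p.2) * (2 * t * (t - 1))).
have [B3 B3_0 B3P] := finite_bound (fun q : ('I_M * 'I_N) * 'I_d =>
  `|(t *: row q.1.2 Y - (t - 1) *: row q.1.1 X) 0 q.2|).
exists (B1 + (1 + B2 + B3)) => [|x]; first by lra.
set w := fun i j => row j x.2 - (t *: row j Y - (t - 1) *: row i X).
set G := avg (fun i j => eps * (expR (logit x i j) - logit x i j)
  + (2 * t * (t - 1))^-1 * dot (w i j) (w i j)) => Gc.
have GE : G = objective P x + avg (fun i j =>
    2^-1 * dot (row i X - row j Y) (row i X - row j Y)).
  by rewrite objective_coerciveE avgD; apply: eq_avg => i j; rewrite subrK.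
have c0 : 0 < 2 * t * (t - 1) by rewrite !mulr_gt0.
have F1 i j : 0 <= eps * (expR (logit x i j) - logit x i j).
  apply: mulr_ge0; first exact: ltW.
  by apply: le_trans (expR_subr_ge_norm _).
have F2 i j : 0 <= (2 * t * (t - 1))^-1 * dot (w i j) (w i j).
  by rewrite mulr_ge0 ?dot_ge0// invr_ge0 ltW.
have GA : G <= A by rewrite GE lerD2r.
have term i j : eps * (expR (logit x i j) - logit x i j)
   + (2 * t * (t - 1))^-1 * dot (w i j) (w i j) <= `|A| / (a i * b j).
  have ab0 : 0 < a i * b j by rewrite mulr_gt0.
  rewrite ler_pdivlMr// mulrC.
  apply: (le_trans _ (ler_norm A)); apply: (le_trans _ GA).
  by apply: avg_ge_term => // k l; rewrite addr_ge0.
split=> [i j|j k].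
  have : `|logit x i j| <= B1.
    apply: le_trans (B1P (i, j)) => /=; rewrite ler_pdivlMr// mulrC.
    apply: le_trans (term i j).
    apply: le_trans (_ : eps * (expR (logit x i j) - logit x i j) <= _).
      by rewrite ler_pM2l// expR_subr_ge_norm.
    by rewrite lerDl.
  by move: B1_0 B2_0 B3_0; lra.
have [i _] := last_index.
have h2 : dot (w i j) (w i j) <= B2.
  apply: le_trans (B2P (i, j)) => /=; rewrite -ler_pdivrMr// mulrC.
  by apply: le_trans (term i j); rewrite lerDr.
have h3 := B3P ((i, j), k); rewrite /= in h3.
have -> : x.2 j k = w i j 0 k + (t *: row j Y - (t - 1) *: row i X) 0 k.
  by rewrite /w !mxE; ring.
apply: le_trans (ler_normD _ _) _.
have := sq_coord_le_dot (w i j) k; have := norm_le_sq (w i j 0 k).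
by move: h3 h2 B1_0; lra.
Qed.

(** Once [phi_M = 0], the exponents of the pairs [(M, j)] control [psi_j], and
    then those of the pairs [(i, j)] control [phi_i]. *)
Lemma sublevel_coord_bounded c : exists2 B, 0 <= B & forall x, normalized x ->
  objective P x <= c ->
  [/\ forall i, `|x.1.1 0 i| <= B, forall j, `|x.1.2 0 j| <= B
    & forall j k, `|x.2 j k| <= B].
Proof.
have [B B0 BP] := sublevel_bounded c.
have [A A0 AP] := finite_bound (fun p : 'I_M * 'I_d => `|X p.1 p.2|).
pose C := (2 * t)^-1 * \sum_(k < d) (B + A) ^+ 2.
have C0 : 0 <= C.
  apply: mulr_ge0; first by rewrite invr_ge0 mulr_ge0// ltW.
  by apply: sumr_ge0 => k _; rewrite sqr_ge0.
exists (B + 2 * (eps * B + C)) => [|x xn xc].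
  by rewrite addr_ge0// mulr_ge0// addr_ge0// mulr_ge0// ltW.
have [Bl Bz] := BP x xc.
have costC i j : `|cost P x.2 i j| <= C.
  rewrite costE ger0_norm; last first.
    by rewrite mulr_ge0 ?dot_ge0// invr_ge0 mulr_ge0// ltW.
  apply: ler_wpM2l; first by rewrite invr_ge0 mulr_ge0// ltW.
  apply: ler_sum => k _.
  rewrite -expr2 -real_normK ?num_real// ler_sqr ?nnegrE ?addr_ge0//.
  rewrite !mxE (le_trans (ler_normB _ _))// lerD//.
  exact: (AP (i, k)).
have sumE i j : x.1.1 0 i + x.1.2 0 j = eps * logit x i j + cost P x.2 i j.
  by rewrite /logit; field.
have sumC i j : `|x.1.1 0 i + x.1.2 0 j| <= eps * B + C.
  rewrite sumE (le_trans (ler_normD _ _))// lerD//.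
  by rewrite normrM gtr0_norm// ler_pM2l.
have [iM iMP] := last_index; have [j0 _] := row_index.
have psiB j : `|x.1.2 0 j| <= eps * B + C.
  by have := sumC iM j; rewrite (xn iM iMP) add0r.
have EB : 0 <= eps * B by rewrite mulr_ge0// ltW.
split=> [i|j|j k]; last by have := Bz j k; move: EB C0; lra.
  have -> : x.1.1 0 i = (x.1.1 0 i + x.1.2 0 j0) - x.1.2 0 j0 by ring.
  apply: le_trans (ler_normB _ _) _.
  by have := sumC i j0; have := psiB j0; move: B0; lra.
by have := psiB j; move: EB C0 B0; lra.
Qed.

(** The point whose [i]-th potential [phi_i] vanishes in the orbit of [x] under
    [(phi, psi) |-> (phi + c, psi - c)], which leaves the objective invariant. *)
Definition normalize (i : 'I_M) x : state R d M N :=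
  (x.1.1 - const_mx (x.1.1 0 i), x.1.2 + const_mx (x.1.1 0 i), x.2).

Lemma objective_normalize i x : objective P (normalize i x) = objective P x.
Proof.
rewrite !objectiveE; apply: eq_avg => k j.
have -> : logit (normalize i x) k j = logit x k j.
  by rewrite /logit/= !mxE; congr (_ / _); ring.
by rewrite /= !mxE; ring.
Qed.

Lemma normalized_normalize (i : 'I_M) x : i.+1 = M -> normalized (normalize i x).
Proof.
move=> iM k kM; have -> : k = i by apply: val_inj; apply: succn_inj; rewrite iM kM.
by rewrite /= !mxE subrr.
Qed.

(** States are flattened to row vectors, among which closed boxes are
    compact. *)
Local Notation coords := ('I_M + 'I_N + 'I_N * 'I_d)%type.

Definition state_of_coords (v : 'rV[R]_#|{: coords}|) : state R d M N :=
  (\row_i v 0 (enum_rank (inl (inl i) : coords)),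
   \row_j v 0 (enum_rank (inl (inr j) : coords)),
   \matrix_(j, k) v 0 (enum_rank (inr (j, k) : coords))).

Definition coords_of_state x : 'rV[R]_#|{: coords}| :=
  \row_l match enum_val l with
         | inl (inl i) => x.1.1 0 i
         | inl (inr j) => x.1.2 0 j
         | inr (j, k) => x.2 j k
         end.

Lemma coords_of_stateK : cancel coords_of_state state_of_coords.
Proof.
case=> [[phi psi] Z]; rewrite /state_of_coords /coords_of_state.
by congr (_, _, _); apply/matrixP => k l; rewrite !mxE ?ord1 enum_rankK.
Qed.

Lemma continuous_objective :
  continuous (fun v => objective P (state_of_coords v)).
Proof.
move=> v.
have cv l : (fun w : 'rV[R]_#|{: coords}| => w 0 l) @ v --> v 0 l.
  exact: coord_continuous.
have dotcv (f g : 'rV[R]_#|{: coords}| -> 'rV[R]_d) :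
    (forall k, (fun w => f w 0 k) @ v --> f v 0 k) ->
    (forall k, (fun w => g w 0 k) @ v --> g v 0 k) ->
    (fun w => dot (f w) (g w)) @ v --> dot (f v) (g v).
  move=> fv gv; apply: (cvg_sumr (F := nbhs v)) => k.
  exact: cvgM (fv k) (gv k).
have Zcv j (u : 'rV[R]_d) k :
    (fun w => (row j (state_of_coords w).2 - u) 0 k) @ v
    --> (row j (state_of_coords v).2 - u) 0 k.
  have -> : (fun w => (row j (state_of_coords w).2 - u) 0 k) =
      (fun w => w 0 (enum_rank (inr (j, k) : coords)) - u 0 k).
    by apply/funext => w; rewrite !mxE.
  have -> : (row j (state_of_coords v).2 - u) 0 k =
      v 0 (enum_rank (inr (j, k) : coords)) - u 0 k by rewrite !mxE.
  exact: cvgB (cv _) (cvg_cst _).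
have phicv i : (fun w => (state_of_coords w).1.1 0 i) @ v
    --> (state_of_coords v).1.1 0 i.
  have -> : (fun w => (state_of_coords w).1.1 0 i) =
      (fun w => w 0 (enum_rank (inl (inl i) : coords))).
    by apply/funext => w; rewrite mxE.
  by rewrite mxE; exact: cv.
have psicv j : (fun w => (state_of_coords w).1.2 0 j) @ v
    --> (state_of_coords v).1.2 0 j.
  have -> : (fun w => (state_of_coords w).1.2 0 j) =
      (fun w => w 0 (enum_rank (inl (inr j) : coords))).
    by apply/funext => w; rewrite mxE.
  by rewrite mxE; exact: cv.
under eq_fun do rewrite objectiveE.
rewrite ?objectiveE /=.
apply: (cvg_sumr (F := nbhs v)) => i.
apply: (cvg_sumr (F := nbhs v)) => j.
apply: cvgM; first exact: cvg_cst.
apply: cvgD; last first.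
  by apply: cvgM; [exact: cvg_cst|apply: dotcv => k; exact: Zcv].
apply: cvgB; last exact: psicv.
apply: cvgB; last exact: phicv.
apply: cvgM; first exact: cvg_cst.
apply: continuous_cvg; first exact: continuous_expR.
apply: cvgM; last exact: cvg_cst.
apply: cvgD; last exact: psicv.
apply: cvgD; last exact: phicv.
apply: cvgN; under eq_fun do rewrite costE; rewrite costE.
by apply: cvgM; [exact: cvg_cst|apply: dotcv => k; exact: Zcv].
Qed.

(** A minimizer over a large box: the box contains every normalized state that
    does better than the zero state, and every state has a normalized
    representative with the same value. *)
Lemma exists_solution : exists x, is_solution P x.
Proof.
have [iM iMP] := last_index.
pose x0 : state R d M N := 0.
have [B B0 BP] := sublevel_coord_bounded (objective P x0).
pose box := [set v : 'rV[R]_#|{: coords}| | forall l, `[- B, B]%classic (v 0 l)].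
have cbox : compact box.
  by apply: (@rV_compact R _ (fun=> `[- B, B]%classic)) => l; exact: segment_compact.
have box0 : box 0 by move=> l /=; rewrite mxE in_itv/= oppr_le0 B0.
have [v vbox vmin] := EVT_min_rV (ex_intro _ _ box0) cbox
  (continuous_subspaceT continuous_objective).
have x00 : state_of_coords 0 = x0.
  by congr (_, _, _); apply/matrixP => k l; rewrite !mxE.
exists (normalize iM (state_of_coords v)); split.
  exact: normalized_normalize.
move=> y; rewrite objective_normalize -(objective_normalize iM y).
set y' := normalize iM y.
have v0 : objective P (state_of_coords v) <= objective P x0.
  by rewrite -x00; apply: vmin; rewrite inE.
have [ys|/ltW/(le_trans v0)//] := leP (objective P y') (objective P x0).
have [h1 h2 h3] := BP y' (normalized_normalize y iMP) ys.
rewrite -(coords_of_stateK y'); apply: vmin; rewrite inE => l /=.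
rewrite mxE in_itv/= -ler_norml.
by case: (enum_val l) => [[i|j]|[j k]].
Qed.

(** The exponents determine the sums [phi_i + psi_j], and the normalization of
    [phi_M] then separates the two potentials. *)
Lemma eq_state_of_logit x y : normalized x -> normalized y -> x.2 = y.2 ->
  (forall i j, logit x i j = logit y i j) -> x = y.
Proof.
case: x y => [[phi psi] Z] [[phi' psi'] Z'] xn yn /= ZZ; subst Z' => lxy.
have [iM iMP] := last_index; have [j0 _] := row_index.
have h i j : phi 0 i + psi 0 j = phi' 0 i + psi' 0 j.
  have := lxy i j; rewrite /logit/= => /(mulIf (invr_neq0 eps_neq0)).
  by rewrite -!addrA => /addrI.
have hpsi j : psi 0 j = psi' 0 j.
  by have := h iM j; rewrite (xn iM iMP : phi 0 iM = 0) (yn iM iMP : phi' 0 iM = 0) !add0r.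
congr (_, _, _); apply/rowP => k; last exact: hpsi.
by have := h k j0; rewrite hpsi => /addIr.
Qed.

(** Uniqueness is strict convexity at the midpoint of the segment joining the
    two minimizers in the coordinates [(phi, psi - |z|^2/(2t), Z)]. *)
Lemma unique_solution x y : is_solution P x -> is_solution P y -> x = y.
Proof.
move=> [xn xmin] [yn ymin].
pose h := 2^-1 *: (y.2 - x.2).
pose m : state R d M N :=
  (2^-1 *: (x.1.1 + y.1.1),
   \row_j (2^-1 * (x.1.2 0 j + y.1.2 0 j) - (2 * t)^-1 * dot (row j h) (row j h)),
   2^-1 *: (x.2 + y.2)).
have hx : x.2 - m.2 = - h by apply/matrixP => k l; rewrite !mxE; field.
have hy : y.2 - m.2 = h by apply/matrixP => k l; rewrite !mxE; field.
have rowN j : row j (- h) = - row j h by apply/rowP => k; rewrite !mxE.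
have := objective_expansion m y; have := objective_expansion m x.
rewrite hx hy.
set Ex := avg _; set Ey := avg _ => ex ey.
(* The increments from [m] to [x] and to [y] are opposite in the convex
   coordinates, so the linear terms of the two expansions cancel. *)
have cancel_lin : objective P x - objective P m + (objective P y - objective P m) = Ex + Ey.
  rewrite {}ex {}ey.
  have e1 : \sum_i grad_phi m i * (x.1.1 0 i - m.1.1 0 i) =
      - \sum_i grad_phi m i * (y.1.1 0 i - m.1.1 0 i).
    rewrite -sumrN; apply: eq_bigr => i _.
    by rewrite -[RHS]mulrN; congr (_ * _); rewrite !mxE; field.
  have e2 : \sum_j grad_psi m j * (x.1.2 0 j - m.1.2 0 j
         - (2 * t)^-1 * dot (row j (- h)) (row j (- h))) =
      - \sum_j grad_psi m j * (y.1.2 0 j - m.1.2 0 j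
         - (2 * t)^-1 * dot (row j h) (row j h)).
    rewrite -sumrN; apply: eq_bigr => j _.
    rewrite rowN !dotE opprK -[RHS]mulrN; congr (_ * _); rewrite mxE; field.
    by rewrite ?t_neq0.
  have e3 : \sum_j dot (grad_Z m j) (row j (- h)) =
      - \sum_j dot (grad_Z m j) (row j h).
    by rewrite -sumrN; apply: eq_bigr => j _; rewrite rowN dotNr.
  by rewrite e1 e2 e3; ring.
have c0 : 0 < (2 * t * (t - 1))^-1 by rewrite invr_gt0 !mulr_gt0.
have T2 z i j := expansion_remainder_ge0 m z i j.
have T1 (u : 'rV[R]_d) : 0 <= (2 * t * (t - 1))^-1 * dot u u.
  by rewrite mulr_ge0 ?dot_ge0// ltW.
have Ex0 : 0 <= Ex by apply: avg_ge0 => // i j; rewrite addr_ge0.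
have Ey0 : 0 <= Ey by apply: avg_ge0 => // i j; rewrite addr_ge0.
have EE : Ex = 0 /\ Ey = 0.
  by have := xmin m; have := ymin m; lra.
have zero (u : 'I_N -> 'rV[R]_d) z i j :
    avg (fun i j => (2 * t * (t - 1))^-1 * dot (u j) (u j) +
      eps * expR (logit m i j) *
      (expR (logit z i j - logit m i j) - 1 - (logit z i j - logit m i j))) = 0 ->
    u j = 0 /\ logit z i j = logit m i j.
  move=> e; have := @avg_ge_term (fun i j =>
      (2 * t * (t - 1))^-1 * dot (u j) (u j) +
      eps * expR (logit m i j) *
      (expR (logit z i j - logit m i j) - 1 - (logit z i j - logit m i j))) i j.
  rewrite e => /(_ (fun i j => addr_ge0 (T1 (u j)) (T2 z i j))).
  rewrite pmulr_rle0 ?mulr_gt0// => le0.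
  have [z1 z2] := (T1 (u j), T2 z i j).
  have [e1 e2] : (2 * t * (t - 1))^-1 * dot (u j) (u j) = 0 /\
    eps * expR (logit m i j) *
      (expR (logit z i j - logit m i j) - 1 - (logit z i j - logit m i j)) = 0.
    by move: z1 z2 le0; lra.
  split; first by apply: dot_eq0; move/eqP: e1; rewrite mulf_eq0 gt_eqF//= => /eqP.
  move/eqP: e2; rewrite !mulf_eq0 (gt_eqF eps_gt0) (gt_eqF (expR_gt0 _))/= => /eqP e2.
  have := expR_quad_lower (logit z i j - logit m i j); rewrite e2 => le2.
  have : (logit z i j - logit m i j) / (2 + `|logit z i j - logit m i j|) == 0.
    by rewrite -sqrf_eq0 eq_le le2 sqr_ge0.
  rewrite mulf_eq0 invr_eq0 (gt_eqF (_ : 0 < 2 + _)) ?orbF.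
    by rewrite subr_eq0 => /eqP.
  by rewrite ltr_wpDr.
case: EE => Ex_0 Ey_0.
have [i0 _] := last_index.
apply: eq_state_of_logit => // [|i j]; last first.
  by rewrite (zero _ _ i j Ex_0).2 (zero _ _ i j Ey_0).2.
apply/matrixP => j k.
have := congr1 (fun u : 'rV_d => u 0 k) (zero (fun j => row j h) _ i0 j Ey_0).1.
rewrite !mxE => e; apply/eqP; rewrite eq_sym -subr_eq0; apply/eqP.
by move: e; lra.
Qed.

(** * Gradient domination *)

(** The squared norm of the gradient in the coordinates left free by
    [phi_M = 0], at a point where the derivatives in [psi] vanish. *)
Definition grad_sq x : R :=
  \sum_(i < M | i.+1 != M) grad_phi x i ^+ 2 + \sum_j dot (grad_Z x j) (grad_Z x j).

(** On a sublevel set the exponents are bounded, so the remainder in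
    [objective_expansion] dominates a positive definite quadratic form [Q] in the
    increments: its terms control the increments of the [z_j] and of the
    exponents, and the latter give those of [phi] because
    [dphi_i = eps (dp_ij - dp_Mj) + (x_M - x_i).dz_j / t] when [dphi_M = 0].
    Minimizing the sum of the linear and quadratic terms over the increments
    bounds the excess of the objective over any other value by the squared
    gradient: a Polyak-Lojasiewicz inequality. *)
Lemma gradient_domination c : exists2 C, 0 < C & forall x y,
  normalized x -> normalized y -> objective P x <= c -> objective P y <= c ->
  (forall j, grad_psi x j = 0) -> objective P x - objective P y <= C * grad_sq x.
Proof.
have [B B0 BP] := sublevel_bounded c.
have [A0 A0_0 A0P] := finite_bound (fun p : 'I_M * 'I_N => (a p.1 * b p.2)^-1).
have [Dx Dx0 DxP] := finite_bound (fun p : 'I_M * 'I_M =>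
  dot (row p.1 X - row p.2 X) (row p.1 X - row p.2 X)).
have [iM iMP] := last_index; have [j0 _] := row_index.
pose al := (2 * t * (t - 1))^-1.
pose ka := eps * expR (- B) / (2 + 2 * B) ^+ 2.
have al0 : 0 < al by rewrite invr_gt0 !mulr_gt0.
have ka0 : 0 < ka.
  apply: divr_gt0; first by rewrite mulr_gt0 ?expR_gt0.
  by apply: exprn_gt0; move: B0; lra.
pose A1 := 3 * (2 * eps ^+ 2 * (A0 / ka) + t^-1 ^+ 2 * (Dx * (A0 / al))).
have r1 : 0 <= A0 / ka by rewrite divr_ge0// ltW.
have r2 : 0 <= A0 / al by rewrite divr_ge0// ltW.
have A1_0 : 0 <= A1.
  apply: mulr_ge0 => //; apply: addr_ge0.
    by rewrite mulr_ge0// mulr_ge0// sqr_ge0.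
  by rewrite mulr_ge0 ?sqr_ge0// mulr_ge0.
pose A2 := A1 + A0 / al + 1.
have A2_0 : 0 < A2 by rewrite ltr_wpDl// addr_ge0.
pose n : R := M%:R + N%:R.
have n0 : 0 < n by rewrite /n ltr_wpDr// ltr0n -iMP.
(* The weight of the quadratic terms in Young's inequality is such that, summed
   over the [M + N] blocks of increments, they add up to [Q]. *)
pose l := (n * A2)^-1.
have l0 : 0 < l by rewrite invr_gt0 mulr_gt0.
exists (4 * l)^-1 => [|x y xn yn xc yc gpsi]; first by rewrite invr_gt0 mulr_gt0.
have [Bx _] := BP x xc; have [By _] := BP y yc.
pose s i j := logit y i j - logit x i j.
pose dz j := row j (y.2 - x.2).
pose dphi i := y.1.1 0 i - x.1.1 0 i.
have dphiM (i : 'I_M) : i.+1 = M -> dphi i = 0 by move=> e; rewrite /dphi xn// yn// subrr.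
pose Q := avg (fun i j => al * dot (dz j) (dz j) + ka * s i j ^+ 2).
have term0 i j : 0 <= al * dot (dz j) (dz j) + ka * s i j ^+ 2.
  by rewrite addr_ge0// mulr_ge0 ?dot_ge0 ?sqr_ge0// ltW.
have Q0 : 0 <= Q by exact: avg_ge0.
have term i j : al * dot (dz j) (dz j) + ka * s i j ^+ 2 <= A0 * Q.
  have ab0 : 0 < a i * b j by rewrite mulr_gt0.
  have := @avg_ge_term _ i j term0; rewrite -/Q -ler_pdivlMl// => h.
  by apply: le_trans h _; rewrite ler_wpM2r//; exact: (A0P (i, j)).
have dzQ j : dot (dz j) (dz j) <= A0 / al * Q.
  rewrite mulrAC ler_pdivlMr// mulrC; apply: le_trans (term iM j).
  by rewrite lerDl mulr_ge0 ?sqr_ge0// ltW.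
have sQ i j : s i j ^+ 2 <= A0 / ka * Q.
  rewrite mulrAC ler_pdivlMr// mulrC; apply: le_trans (term i j).
  by rewrite lerDr mulr_ge0 ?dot_ge0// ltW.
have dphiQ i : dphi i ^+ 2 <= A1 * Q.
  have -> : dphi i = eps * s i j0 - eps * s iM j0
      + t^-1 * dot (row iM X - row i X) (dz j0).
    rewrite /s !logitB -/(dphi i) -/(dphi iM) (dphiM _ iMP) -/(dz j0).
    by rewrite !(dotBl _ _ (dz j0)); ring.
  have h1 := sQ i j0; have h2 := sQ iM j0.
  have h3 : dot (row iM X - row i X) (dz j0) ^+ 2 <= Dx * (A0 / al * Q).
    apply: le_trans (dot_cauchy_schwarz _ _) _.
    by apply: ler_pM; rewrite ?dot_ge0//; exact: (DxP (iM, i)).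
  have sq3 (u v w : R) : (u - v + w) ^+ 2 <= 3 * (u ^+ 2 + v ^+ 2 + w ^+ 2).
    have := sqr_ge0 (u + v); have := sqr_ge0 (u - w); have := sqr_ge0 (v + w).
    by nra.
  apply: le_trans (sq3 _ _ _) _; rewrite !exprMn.
  have -> : A1 * Q = 3 * (eps ^+ 2 * (A0 / ka * Q) + eps ^+ 2 * (A0 / ka * Q)
      + t^-1 ^+ 2 * (Dx * (A0 / al * Q))) by rewrite /A1; ring.
  by rewrite ler_pM2l// !lerD// ler_wpM2l ?sqr_ge0.
have remQ : Q <= avg (fun i j =>
      (2 * t * (t - 1))^-1 * dot (dz j) (dz j)
      + eps * expR (logit x i j) * (expR (s i j) - 1 - s i j)).
  apply: le_avg => i j; rewrite lerD2l.
  have sB : `|s i j| <= 2 * B.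
    apply: le_trans (ler_normB _ _) _.
    by have := Bx i j; have := By i j; lra.
  have hs := expR_quad_lower_bounded sB.
  have -> : ka * s i j ^+ 2 =
      eps * expR (- B) * (s i j ^+ 2 / (2 + 2 * B) ^+ 2) by rewrite /ka; ring.
  apply: ler_pM => //.
  - by rewrite mulr_ge0 ?expR_ge0 ?ltW.
  - by rewrite divr_ge0 ?sqr_ge0.
  - by rewrite ler_pM2l// ler_expR; have := Bx i j; rewrite ler_norml => /andP[].
rewrite -opprB objective_expansion lerNl.
have -> : \sum_j grad_psi x j * (y.1.2 0 j - x.1.2 0 j
    - (2 * t)^-1 * dot (row j (y.2 - x.2)) (row j (y.2 - x.2))) = 0.
  by rewrite big1// => j _; rewrite gpsi mul0r.
rewrite addr0.
have phi_part : - ((4 * l)^-1 * \sum_(i < M | i.+1 != M) grad_phi x i ^+ 2)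
    - l * (M%:R * (A2 * Q)) <= \sum_i grad_phi x i * dphi i.
  rewrite [X in _ <= X](bigID (fun i : 'I_M => i.+1 != M))/=.
  rewrite [X in _ <= _ + X]big1 ?addr0; last first.
    by move=> i /negPn/eqP iE; rewrite dphiM// mulr0.
  apply: (@le_trans _ _ (\sum_(i < M | i.+1 != M)
      (- (grad_phi x i ^+ 2 / (4 * l)) - l * (A2 * Q)))).
    rewrite sumrB sumrN -mulr_suml [in leLHS](mulrC (4 * l)^-1) lerD2l.
    rewrite lerN2 sumr_const [leRHS]mulrCA -[leLHS]mulr_natl ler_wpM2r//.
      by rewrite mulr_ge0 ?(ltW l0)// mulr_ge0// ltW.
    by rewrite ler_nat -[X in (_ <= X)%N]card_ord max_card.
  apply: ler_sum => i _; apply: le_trans (mulr_ge_young _ _ l0).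
  rewrite lerB// ler_pM2l//; apply: le_trans (dphiQ i) _.
  by rewrite ler_wpM2r// /A2 -addrA lerDl addr_ge0.
have Z_part : - ((4 * l)^-1 * \sum_j dot (grad_Z x j) (grad_Z x j))
    - l * (N%:R * (A2 * Q)) <= \sum_j dot (grad_Z x j) (dz j).
  apply: (@le_trans _ _ (\sum_(j < N)
      (- (dot (grad_Z x j) (grad_Z x j) / (4 * l)) - l * (A2 * Q)))).
    rewrite sumrB sumrN -mulr_suml [in leLHS](mulrC (4 * l)^-1) lerD2l.
    by rewrite lerN2 sumr_const card_ord [leRHS]mulrCA -[leLHS]mulr_natl.
  apply: ler_sum => j _; apply: le_trans (dot_ge_young _ _ l0).
  rewrite lerB// ler_pM2l//; apply: le_trans (dzQ j) _.
  by rewrite ler_wpM2r// /A2 -addrA addrCA lerDl addr_ge0.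
have lQ : l * (M%:R * (A2 * Q)) + l * (N%:R * (A2 * Q)) = Q.
  by rewrite /l /n; field; rewrite gt_eqF//= gt_eqF.
move: phi_part Z_part remQ; rewrite /grad_sq mulrDr -/(dz _).
rewrite /dphi /dz /s.
lra.
Qed.

(** * Decrease along the potential updates *)

Definition phi_state x : state R d M N := (phi_step P x.1.2 x.2, x.1.2, x.2).

Lemma potential_stepE x : potential_step P x =
  (phi_step P x.1.2 x.2, psi_step P (phi_step P x.1.2 x.2) x.2, x.2).
Proof. by case: x => [[phi psi] Z]. Qed.

Lemma phi_state_marginal x (i : 'I_M) : i.+1 != M ->
  \sum_j b j * expR (logit (phi_state x) i j) = 1.
Proof.
move=> iM; set S := \sum_j b j * expR ((- cost P x.2 i j + x.1.2 0 j) / eps).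
have S0 : 0 < S by exact: sum_weighted_expR_gt0.
have e j : b j * expR (logit (phi_state x) i j) =
    b j * expR ((- cost P x.2 i j + x.1.2 0 j) / eps) * S^-1.
  rewrite -mulrA; congr (_ * _); rewrite -[X in _ * X](lnK (x := S^-1)) ?posrE ?invr_gt0//.
  rewrite lnV ?posrE// -expRD; congr expR.
  by rewrite /logit/= mxE (negbTE iM) -/S; field.
by rewrite (eq_bigr _ (fun j _ => e j)) -mulr_suml -/S divff// gt_eqF.
Qed.

Lemma potential_step_marginal x j :
  \sum_i a i * expR (logit (potential_step P x) i j) = 1.
Proof.
rewrite potential_stepE; move: (phi_step _ _ _) => phi.
set S := \sum_i a i * expR ((- cost P x.2 i j + phi 0 i) / eps).
have S0 : 0 < S by exact: sum_weighted_expR_gt0.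
have e i : a i * expR (logit (phi, psi_step P phi x.2, x.2) i j) =
    a i * expR ((- cost P x.2 i j + phi 0 i) / eps) * S^-1.
  rewrite -mulrA; congr (_ * _); rewrite -[X in _ * X](lnK (x := S^-1)) ?posrE ?invr_gt0//.
  rewrite lnV ?posrE// -expRD; congr expR.
  by rewrite /logit/= mxE -/S; field.
by rewrite (eq_bigr _ (fun i _ => e i)) -mulr_suml -/S divff// gt_eqF.
Qed.

Lemma grad_psi_potential_step x j : grad_psi (potential_step P x) j = 0.
Proof. by rewrite /grad_psi potential_step_marginal subrr mulr0. Qed.

Lemma normalized_phi_state x : normalized (phi_state x).
Proof. by move=> i iM; rewrite mxE iM eqxx. Qed.

Lemma normalized_potential_step x : normalized (potential_step P x).
Proof. by rewrite potential_stepE => i iM; rewrite mxE iM eqxx. Qed.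

Lemma objective_expansion_potentials x y : y.2 = x.2 ->
  objective P y - objective P x =
  \sum_i grad_phi x i * (y.1.1 0 i - x.1.1 0 i)
  + \sum_j grad_psi x j * (y.1.2 0 j - x.1.2 0 j)
  + avg (fun i j => eps * expR (logit x i j) *
        (expR (logit y i j - logit x i j) - 1
         - (logit y i j - logit x i j))).
Proof.
move=> yx; rewrite objective_expansion yx subrr.
have r0 j : row j (0 : 'M[R]_(N, d)) = 0 by apply/rowP => k; rewrite !mxE.
have d0 (u : 'rV[R]_d) : dot u 0 = 0.
  by rewrite /dot big1// => k _; rewrite mxE mulr0.
rewrite [X in _ + X + _]big1 => [|j _]; last by rewrite r0 d0.
rewrite addr0; congr (_ + _ + _).
  by apply: eq_bigr => j _; rewrite r0 d0 mulr0 subr0.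
by apply: eq_avg => i j; rewrite r0 d0 mulr0 add0r.
Qed.

Lemma phi_state_le x : normalized x -> objective P (phi_state x) <= objective P x.
Proof.
move=> xn; rewrite -subr_ge0 objective_expansion_potentials//.
rewrite big1 => [|i _].
  rewrite big1 => [|j _]; last by rewrite subrr mulr0.
  by rewrite !add0r; apply: avg_ge0 => i j; exact: expansion_remainder_ge0.
have [iM|iM] := eqVneq i.+1 M.
  by rewrite xn// normalized_phi_state// subrr mulr0.
by rewrite /grad_phi phi_state_marginal// subrr mulr0 mul0r.
Qed.

Lemma psi_update_decrease x : objective P (phi_state x) - objective P (potential_step P x)
  = avg (fun i j => eps * expR (logit (potential_step P x) i j) *
      (expR (logit (phi_state x) i j - logit (potential_step P x) i j) - 1
       - (logit (phi_state x) i j - logit (potential_step P x) i j))).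
Proof.
rewrite objective_expansion_potentials; last by rewrite potential_stepE.
rewrite big1 => [|i _]; last by rewrite potential_stepE /= subrr mulr0.
rewrite big1 => [|j _]; last by rewrite grad_psi_potential_step mul0r.
by rewrite !add0r.
Qed.

Lemma potential_step_le x : normalized x ->
  objective P (potential_step P x) <= objective P x.
Proof.
move=> xn; apply: le_trans (phi_state_le xn); rewrite -subr_ge0.
rewrite psi_update_decrease; apply: avg_ge0 => i j.
exact: expansion_remainder_ge0.
Qed.

(** The update of [psi] destroys the optimality in [phi] obtained just before,
    but no more than it decreases the objective: both effects are governed by
    the change [s] of the exponents, the first through
    [|1 - expR s|^2] and the second through [expR s - 1 - s]. *)
Lemma potential_step_decrease c : exists2 C, 0 < C & forall x,
  normalized x -> objective P x <= c ->
  \sum_(i < M | i.+1 != M) grad_phi (potential_step P x) i ^+ 2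
    <= C * (objective P x - objective P (potential_step P x)).
Proof.
have [B B0 BP] := sublevel_bounded c.
pose K := 2 * (expR (2 * B) + 1).
have K0 : 0 < K by rewrite mulr_gt0// addr_gt0 ?expR_gt0.
exists (K / eps) => [|x xn xc]; first by rewrite divr_gt0.
set x1 := phi_state x; set x2 := potential_step P x.
have x1c : objective P x1 <= c by apply: le_trans xc; exact: phi_state_le.
have x2c : objective P x2 <= c by apply: le_trans xc; exact: potential_step_le.
have [B1 _] := BP x1 x1c; have [B2 _] := BP x2 x2c.
apply: (@le_trans _ _ (K / eps * (objective P x1 - objective P x2))); last first.
  by rewrite ler_pM2l ?divr_gt0// lerD2r phi_state_le.
rewrite psi_update_decrease -/x1 -/x2 avgZ big_mkcond; apply: ler_sum => i _.
pose s j := logit x1 i j - logit x2 i j.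
pose p j := a i * expR (logit x2 i j).
have p0 j : 0 <= p j by rewrite mulr_ge0 ?expR_ge0// ltW.
have p1 j : p j <= 1.
  rewrite -(potential_step_marginal x j) -/x2 (bigD1 i)//= -/(p j) lerDl.
  by apply: sumr_ge0 => k _; rewrite mulr_ge0 ?expR_ge0// ltW.
case: ifPn => iM; last first.
  apply: sumr_ge0 => j _; apply: mulr_ge0; first by rewrite mulr_ge0// ltW.
  by apply: mulr_ge0; [rewrite divr_ge0// ltW | exact: expansion_remainder_ge0].
have -> : grad_phi x2 i = \sum_j b j * (p j * (1 - expR (s j))).
  (* The optimality in [phi] before the update of [psi] replaces the constant 1. *)
  rewrite /grad_phi -{1}(phi_state_marginal x iM) -sumrB mulr_sumr.
  apply: eq_bigr => j _; rewrite [p j * _]mulrBr mulr1.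
  have -> : p j * expR (s j) = a i * expR (logit x1 i j).
    by rewrite -mulrA -expRD; congr (_ * expR _); rewrite /s; ring.
  by rewrite /p; ring.
apply: le_trans (mean_sqr_le _ _ b_sum) _; first by move=> j; exact: ltW.
apply: ler_sum => j _.
have -> : a i * b j * (K / eps * (eps * expR (logit x2 i j) *
    (expR (logit x1 i j - logit x2 i j) - 1 - (logit x1 i j - logit x2 i j))))
    = b j * (p j * (K * (expR (s j) - 1 - s j))).
  by rewrite /p /s; field.
rewrite ler_pM2l// exprMn expr2 -mulrA ler_wpM2l//.
have sB : s j <= 2 * B.
  have := B1 i j; have := B2 i j; rewrite !ler_norml => /andP[h1 h2] /andP[h3 h4].
  by rewrite /s; lra.
have h := expR_subr1_sq_le sB.
have -> : (1 - expR (s j)) ^+ 2 = (expR (s j) - 1) ^+ 2 by ring.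
by apply: le_trans h; rewrite ler_piMl ?sqr_ge0.
Qed.

Lemma is_derive_avg (f : 'I_M -> 'I_N -> R -> R) (df : 'I_M -> 'I_N -> R) (s : R) :
  (forall i j, is_derive s 1 (f i j) (df i j)) ->
  is_derive s 1 (fun s => avg (fun i j => f i j s)) (avg df).
Proof.
move=> h; rewrite /avg.
have -> : (fun s => \sum_i \sum_j a i * b j * f i j s) =
    \sum_i \sum_j (a i * b j) *: f i j.
  apply/funext => u; rewrite fct_sumE; apply: eq_bigr => i _.
  by rewrite fct_sumE; apply: eq_bigr.
by apply: is_derive_sum => i; apply: is_derive_sum => j.
Qed.

(** * The Hessian in Z *)

(** Second derivative of the objective in the directions [h] and [h'] of [Z]. *)
Definition hess_form x (h h' : 'M[R]_(N, d)) : R := avg (fun i j =>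
  (t - 1)^-1 * dot (row j h) (row j h')
  + expR (logit x i j) / t *
    ((t * eps)^-1 * dot (row j x.2 - row i X) (row j h)
       * dot (row j x.2 - row i X) (row j h')
     - dot (row j h) (row j h'))).

Lemma logit_line (p : 'rV[R]_M * 'rV[R]_N) (Z h : 'M[R]_(N, d)) s i j :
  logit (p, Z + s *: h) i j = logit (p, Z) i j
   + (- ((t * eps)^-1 * dot (row j Z - row i X) (row j h))) * s
   + (- ((2 * t * eps)^-1 * dot (row j h) (row j h))) * s ^+ 2.
Proof.
rewrite /logit !costE/= rowDZ (addrAC (row j Z)  _ (- row i X)).
move: (row j Z - row i X) (row j h) => u v.
by rewrite !dotE (dotC v u); field; rewrite eps_neq0 t_neq0.
Qed.

Lemma is_derive_objective_line (p : 'rV[R]_M * 'rV[R]_N) (Z h : 'M[R]_(N, d)) (s : R) :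
  is_derive s 1 (fun s => objective P (p, Z + s *: h))
    (\sum_j dot (grad_Z (p, Z + s *: h) j) (row j h)).
Proof.
rewrite dot_grad_Z.
under eq_fun do rewrite objectiveE.
apply: is_derive_avg => i j.
set q1 := - ((t * eps)^-1 * dot (row j Z - row i X) (row j h)).
set q2 := - ((2 * t * eps)^-1 * dot (row j h) (row j h)).
have [Ey EyE] : exists v, row j Z - row j Y = v by eexists.
have := is_derive_expR_quadratic (logit (p, Z) i j) q1 q2 eps 0
  ((2 * (t - 1))^-1 * dot Ey Ey - p.1 0 i - p.2 0 j)
  ((t - 1)^-1 * dot Ey (row j h)) ((2 * (t - 1))^-1 * dot (row j h) (row j h)) s.
set F := (fun s => _); set D := (_ + _) => FD.
have -> : (fun s => eps * expR (logit (p, Z + s *: h) i j)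
    - (p, Z + s *: h).1.1 0 i - (p, Z + s *: h).1.2 0 j + (2 * (t - 1))^-1 *
    dot (row j (p, Z + s *: h).2 - row j Y) (row j (p, Z + s *: h).2 - row j Y)) = F.
  apply/funext => u; rewrite /F logit_line -/q1 -/q2 /= rowDZ (addrAC (row j Z) _ (- row j Y)) EyE.
  rewrite !dotE (dotC (row j h) Ey); field.
  by rewrite t1_neq0.
apply: (is_derive_eq FD); rewrite /D logit_line -/q1 -/q2 /= rowDZ.
rewrite (addrAC (row j Z) _ (- row j Y)) (addrAC (row j Z) _ (- row i X)) EyE !dotE /q1 /q2 !dotE; field.
by rewrite ?t1_neq0 ?t_neq0 ?eps_neq0.
Qed.

Lemma is_derive_grad_line (p : 'rV[R]_M * 'rV[R]_N) (Z h h' : 'M[R]_(N, d)) (s : R) :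
  is_derive s 1 (fun s => \sum_j dot (grad_Z (p, Z + s *: h') j) (row j h))
    (hess_form (p, Z + s *: h') h h').
Proof.
under eq_fun do rewrite dot_grad_Z.
apply: is_derive_avg => i j.
set q1 := - ((t * eps)^-1 * dot (row j Z - row i X) (row j h')).
set q2 := - ((2 * t * eps)^-1 * dot (row j h') (row j h')).
have [Ey EyE] : exists v, row j Z - row j Y = v by eexists.
have := is_derive_expR_quadratic (logit (p, Z) i j) q1 q2
  (- t^-1 * dot (row j Z - row i X) (row j h)) (- t^-1 * dot (row j h') (row j h))
  ((t - 1)^-1 * dot Ey (row j h)) ((t - 1)^-1 * dot (row j h') (row j h)) 0 s.
set F := (fun s => _); set D := (_ + _) => FD.
have -> : (fun s => (t - 1)^-1 *
    dot (row j (p, Z + s *: h').2 - row j Y) (row j h) -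
    expR (logit (p, Z + s *: h') i j) / t *
    dot (row j (p, Z + s *: h').2 - row i X) (row j h)) = F.
  apply/funext => u; rewrite /F logit_line -/q1 -/q2 /= rowDZ.
  by rewrite (addrAC (row j Z) _ (- row j Y)) (addrAC (row j Z) _ (- row i X)) EyE !dotE; ring.
apply: (is_derive_eq FD); rewrite /D logit_line -/q1 -/q2 /= rowDZ.
rewrite (addrAC (row j Z) _ (- row i X)); move: (expR _) => E0.
rewrite /q1 /q2 !dotE (dotC (row j h') (row j h)); field.
by rewrite ?t1_neq0 ?t_neq0 ?eps_neq0.
Qed.

Lemma hessZE x p q :
  hessZ P x p q = hess_form x (delta_mx q.1 q.2) (delta_mx p.1 p.2).
Proof.
case: x => [w Z]; rewrite /hessZ /=.
have -> : (fun Z => 'D_(delta_mx q.1 q.2 : 'M[R]_(N, d))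
    (fun Z0 => objective P (w, Z0)) Z) =
    (fun Z => \sum_j dot (grad_Z (w, Z) j) (row j (delta_mx q.1 q.2))).
  apply/funext => Z0; apply: derive_val; apply: is_derive_line.
  have := is_derive_objective_line w Z0 (delta_mx q.1 q.2) 0.
  by rewrite scale0r addr0.
apply: derive_val; apply: is_derive_line.
have := is_derive_grad_line w Z (delta_mx q.1 q.2) (delta_mx p.1 p.2) 0.
by rewrite scale0r addr0.
Qed.

Lemma hessZ_quadE x h : hessZ_quad P x h = hess_form x h h.
Proof.
pose dl (q : 'I_N * 'I_d) := delta_mx q.1 q.2 : 'M[R]_(N, d).
have hh j : \sum_p \sum_q h q.1 q.2 * h p.1 p.2 * dot (row j (dl q)) (row j (dl p))
    = dot (row j h) (row j h).
  rewrite -[RHS]dot_row_sum_delta; apply: eq_bigr => p _.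
  rewrite dotC -dot_row_sum_delta mulr_sumr; apply: eq_bigr => q _.
  by rewrite dotC; ring.
have ee i j : \sum_p \sum_q h q.1 q.2 * h p.1 p.2 *
      (dot (row j x.2 - row i X) (row j (dl q))
       * dot (row j x.2 - row i X) (row j (dl p))) =
    dot (row j x.2 - row i X) (row j h) * dot (row j x.2 - row i X) (row j h).
  rewrite -{1}[dot _ (row j h)]dot_row_sum_delta -[dot _ (row j h)]dot_row_sum_delta.
  rewrite mulr_sumr; apply: eq_bigr => p _; rewrite mulr_suml.
  by apply: eq_bigr => q _; ring.
rewrite /hessZ_quad.
transitivity (\sum_p \sum_q avg (fun i j => h q.1 q.2 * h p.1 p.2 *
  ((t - 1)^-1 * dot (row j (dl q)) (row j (dl p))
  + expR (logit x i j) / t *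
    ((t * eps)^-1 * dot (row j x.2 - row i X) (row j (dl q))
       * dot (row j x.2 - row i X) (row j (dl p))
     - dot (row j (dl q)) (row j (dl p)))))).
  apply: eq_bigr => p _; apply: eq_bigr => q _.
  by rewrite hessZE -avgZ -/(hess_form _ _ _); ring.
have sum_avg (I : finType) (F : I -> 'I_M -> 'I_N -> R) :
    \sum_p avg (F p) = avg (fun i j => \sum_p F p i j).
  rewrite /avg exchange_big/=; apply: eq_bigr => i _.
  rewrite exchange_big/=; apply: eq_bigr => j _.
  by rewrite mulr_sumr.
under eq_bigr do rewrite sum_avg.
rewrite sum_avg; apply: eq_avg => i j.
pose k1 := (t - 1)^-1 - expR (logit x i j) / t.
pose k2 := expR (logit x i j) / t * (t * eps)^-1.
rewrite (eq_bigr (fun p =>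
  k1 * \sum_q h q.1 q.2 * h p.1 p.2 * dot (row j (dl q)) (row j (dl p))
  + k2 * \sum_q h q.1 q.2 * h p.1 p.2 *
      (dot (row j x.2 - row i X) (row j (dl q))
       * dot (row j x.2 - row i X) (row j (dl p))))) => [|p _].
  by rewrite big_split/= -!mulr_sumr hh ee /k1 /k2; ring.
rewrite !mulr_sumr -big_split/=; apply: eq_bigr => q _.
by rewrite /k1 /k2; ring.
Qed.

(** * Decrease along the gradient step *)

Lemma row_Z_step tau x j :
  row j (Z_step P tau x.1.1 x.1.2 x.2) = row j x.2 - tau *: grad_Z x j.
Proof. by case: x => [[phi psi] Z]; apply/rowP => k; rewrite !mxE. Qed.

Lemma hess_formZ x c h : hess_form x (c *: h) (c *: h) = c ^+ 2 * hess_form x h h.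
Proof.
rewrite /hess_form avgZ; apply: eq_avg => i j.
have -> : row j (c *: h) = c *: row j h by apply/rowP => k; rewrite !mxE.
by rewrite !dotE; ring.
Qed.

(** The descent lemma: a gradient step of length at most the inverse of the
    largest curvature met along the step realizes at least half of the decrease
    predicted by the linearization. *)
Lemma Z_step_decrease tau x : 0 < tau ->
  (forall s h, 0 <= s <= 1 -> enorm h = 1 ->
     hessZ_quad P ((1 - s) *: x + s *: (x.1, Z_step P tau x.1.1 x.1.2 x.2)) h
     <= tau^-1) ->
  tau / 2 * \sum_j dot (grad_Z x j) (grad_Z x j)
    <= objective P x - objective P (x.1, Z_step P tau x.1.1 x.1.2 x.2).
Proof.
move=> tau0; case: x => [p Z]; set Z' := Z_step _ _ _ _ _ => hess_le.
set G := \sum_j _.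
pose h := Z' - Z.
have hrow j : row j h = - tau *: grad_Z (p, Z) j.
  have -> : row j h = row j Z' - row j Z by apply/rowP => k; rewrite !mxE.
  by rewrite (row_Z_step tau (p, Z)) addrC addrA addNr add0r scaleNr.
have hG : \sum_j dot (row j h) (row j h) = tau ^+ 2 * G.
  by rewrite mulr_sumr; apply: eq_bigr => j _; rewrite hrow !dotE; ring.
have bound s : 0 <= s <= 1 -> hess_form (p, Z + s *: h) h h <= tau * G.
  move=> s01.
  (* The curvature bound is about unit vectors, hence the rescaling of [h]. *)
  have [h0|h0] := eqVneq (enorm h) 0.
    have e := hG; rewrite -enorm_sq_rows h0 expr0n/= in e.
    have G0 : G = 0.
      by apply/eqP; move/esym/eqP: e; rewrite mulf_eq0 expf_eq0/= (gt_eqF tau0).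
    have -> : h = 0 *: h.
      rewrite scale0r; apply/row_matrixP => j; rewrite row0; apply: dot_eq0.
      apply/eqP; rewrite eq_le dot_ge0 andbT -(mulr0 (tau ^+ 2)) -G0 -hG.
      by rewrite (bigD1 j)//= lerDl sumr_ge0// => k _; exact: dot_ge0.
    by rewrite hess_formZ expr0n/= mul0r G0 mulr0.
  pose h1 := (enorm h)^-1 *: h.
  have hE : enorm h *: h1 = h by rewrite scalerA divff// scale1r.
  rewrite -[X in hess_form _ X]hE -[X in hess_form _ _ X]hE.
  rewrite hess_formZ enorm_sq_rows hG -hessZ_quadE.
  have -> : tau * G = tau ^+ 2 * G * tau^-1 by field; rewrite gt_eqF.
  apply: ler_wpM2l.
    by rewrite mulr_ge0 ?sqr_ge0//; apply: sumr_ge0 => j _; exact: dot_ge0.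
  have -> : (p, Z + s *: h) = (1 - s) *: (p, Z) + s *: (p, Z').
    congr (_, _).
      by rewrite -scalerDl subrK scale1r.
    by rewrite /h/=; apply/matrixP => k l; rewrite !mxE; ring.
  apply: hess_le => //.
  have e0 : 0 <= enorm h by exact: sqrtr_ge0.
  have : enorm h1 ^+ 2 = 1.
    rewrite enorm_sq_rows.
    have -> : \sum_j dot (row j h1) (row j h1)
        = (enorm h)^-1 ^+ 2 * \sum_j dot (row j h) (row j h).
      rewrite mulr_sumr; apply: eq_bigr => j _.
      have -> : row j h1 = (enorm h)^-1 *: row j h.
        by apply/rowP => k; rewrite !mxE.
      by rewrite !dotE; ring.
    by rewrite -enorm_sq_rows -exprMn mulVf// expr1n.
  move/eqP; rewrite sqrf_eq1 => /orP[/eqP//|/eqP e].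
  by have := sqrtr_ge0 (\sum_i \sum_j h1 i j ^+ 2); rewrite -/(enorm _) e; lra.
have := taylor2_upper (is_derive_objective_line p Z h)
  (is_derive_grad_line p Z h h) bound.
rewrite scale1r scale0r addr0 /h addrC subrK.
have -> : \sum_j dot (grad_Z (p, Z) j) (row j (Z' - Z)) = - (tau * G).
  rewrite mulr_sumr -sumrN; apply: eq_bigr => j _.
  by rewrite -/h hrow dotZr mulNr.
by lra.
Qed.

(** * Linear convergence under a curvature bound *)

Lemma full_stepE tau x : full_step P tau x =
  ((potential_step P x).1,
   Z_step P tau (potential_step P x).1.1 (potential_step P x).1.2
     (potential_step P x).2).
Proof. by rewrite /full_step; case: (potential_step P x) => [[phi psi] Z]. Qed.

Lemma iterateS tau x0 n :
  iterate P tau x0 n.+1 = full_step P tau (iterate P tau x0 n).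
Proof. by []. Qed.

(** The inequality [L_Z <= 1/tau], unfolded into real inequalities along the
    segments on which the supremum [L_Z] is taken. *)
Definition curvature_bounded tau x0 : Prop := forall n s h, 0 <= s <= 1 ->
  enorm h = 1 ->
  hessZ_quad P ((1 - s) *: potential_step P (iterate P tau x0 n)
                + s *: iterate P tau x0 n.+1) h <= tau^-1.

(** Let [y] be the state reached from [x] after the potential updates, and [x']
    the next iterate.  The gradient at [y] vanishes in [psi]; its [phi] part is
    controlled by the decrease from [x] to [y], its [Z] part by the decrease from
    [y] to [x'].  Gradient domination at [y] thus gives
    [f x' - f xs <= f y - f xs <= K (f x - f x')], which rearranges into a
    contraction of ratio [K / (1 + K)]. *)
Lemma linear_rate tau x0 xs : 0 < tau -> normalized x0 -> is_solution P xs ->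
  curvature_bounded tau x0 ->
  exists2 eta : R, 0 < eta < 1 & forall n,
    objective P (iterate P tau x0 n.+1) - objective P xs
      <= eta * (objective P (iterate P tau x0 n) - objective P xs).
Proof.
move=> tau0 x0n [xsn xsmin] curv.
set c := objective P x0.
have [C C0 CP] := gradient_domination c.
have [C1 C1_0 C1P] := potential_step_decrease c.
pose K := C * (C1 + 2 / tau).
have K0 : 0 < K by rewrite mulr_gt0// addr_gt0// divr_gt0.
have Zdec n : let y := potential_step P (iterate P tau x0 n) in
    tau / 2 * \sum_j dot (grad_Z y j) (grad_Z y j)
    <= objective P y - objective P (iterate P tau x0 n.+1).
  move=> y; rewrite iterateS full_stepE -/y; apply: Z_step_decrease => // s h s01 h1.
  by have := curv n s h s01 h1; rewrite iterateS full_stepE -/y.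
have gradZ_ge0 y : 0 <= \sum_j dot (grad_Z y j) (grad_Z y j).
  by apply: sumr_ge0 => j _; exact: dot_ge0.
have inv n : normalized (iterate P tau x0 n) /\ objective P (iterate P tau x0 n) <= c.
  elim: n => [|n [xn xc]]; first by [].
  split.
    rewrite iterateS full_stepE => i iM.
    exact: (@normalized_potential_step (iterate P tau x0 n)) iM.
  apply: (le_trans _ xc); apply: le_trans (potential_step_le xn).
  rewrite -subr_ge0; apply: le_trans (Zdec n).
  by rewrite mulr_ge0// divr_ge0// ltW.
exists (K / (1 + K)) => [|n].
  by rewrite divr_gt0 ?addr_gt0//= ltr_pdivrMr ?addr_gt0// mul1r ltrDr.
have [xn xc] := inv n; have Zd := Zdec n; have C1n := C1P _ xn xc.
set x := iterate P tau x0 n in xn xc Zd C1n *; set x' := iterate P tau x0 n.+1.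
set y := potential_step P x in Zd C1n.
have yx := potential_step_le xn; rewrite -/y in yx.
have yn : normalized y by exact: normalized_potential_step.
have yc : objective P y <= c by exact: le_trans xc.
have PL := CP y xs yn xsn yc (xsmin x0) (grad_psi_potential_step x).
have x'y : objective P x' <= objective P y.
  by rewrite -subr_ge0; apply: le_trans Zd; rewrite mulr_ge0// divr_ge0// ltW.
have Gle : grad_sq y <= (C1 + 2 / tau) * (objective P x - objective P x').
  have h1 : C1 * (objective P x - objective P y)
      <= C1 * (objective P x - objective P x') by rewrite ler_pM2l// lerB.
  have h2 : \sum_j dot (grad_Z y j) (grad_Z y j)
      <= 2 / tau * (objective P x - objective P x').
    rewrite -ler_pdivrMl ?divr_gt0// invf_div.
    by apply: le_trans Zd _; rewrite lerB.
  by rewrite mulrDl; apply: lerD => //; apply: le_trans h1.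
have : objective P x' - objective P xs
    <= K * (objective P x - objective P x').
  apply: (@le_trans _ _ (objective P y - objective P xs)); first by rewrite lerB.
  by apply: le_trans PL _; rewrite /K -mulrA ler_pM2l.
by move=> h; rewrite mulrAC ler_pdivlMr ?addr_gt0//; move: h; lra.
Qed.

(** The inverse of [+oo] being [0] and [tau] being positive, the hypothesis
    includes the finiteness of [LZ]. *)
Lemma curvature_bounded_of_LZ tau x0 : 0 < tau ->
  (tau%:E <= (LZ P tau x0)^-1)%E -> curvature_bounded tau x0.
Proof.
move=> tau0 tauL n s h s01 h1.
set q := hessZ_quad _ _ _.
have : (q%:E <= LZ P tau x0)%E.
  by apply: ereal_sup_ubound; exists n, s, h.
move: tauL; case: (LZ P tau x0) => [r| |] //; last by rewrite invey lee_fin leNgt tau0.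
rewrite inver; case: eqP => [->|/eqP r0] taur.
  by rewrite lee_fin => /le_trans; apply; rewrite invr_ge0 ltW.
move: taur; rewrite !lee_fin => taur qr; apply: (le_trans qr).
have r0' : 0 < r by rewrite -invr_gt0; apply: lt_le_trans taur.
by rewrite -(invrK r) lef_pV2 ?posrE ?invr_gt0.
Qed.

(** * Curvature along the iterations *)

(** Membership of [z_j] in [t y_j - (t-1) conv(X)], which the iterations
    preserve. *)
Definition extrapolated (Z : 'M[R]_(N, d)) j : Prop :=
  exists2 u, conv_hull X u & row j Z = t *: row j Y - (t - 1) *: u.

Section Curvature.
Variables (D beta : R).
Hypothesis D_ge0 : 0 <= D.
Hypothesis distXY : forall i j, dot (row j Y - row i X) (row j Y - row i X) <= D ^+ 2.
Hypothesis b_le : forall j, b j <= beta.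

Lemma extrapolated_dist Z i j : extrapolated Z j ->
  dot (row j Z - row i X) (row j Z - row i X) <= (t * D) ^+ 2.
Proof.
move=> [u uX ->].
have -> : t *: row j Y - (t - 1) *: u - row i X =
    (t *: row j Y - row i X) - (t - 1) *: u by rewrite addrAC.
apply: conv_hull_dist_le uX _ => l.
have -> : t *: row j Y - row i X - (t - 1) *: row l X =
    (row j Y - row i X) + (t - 1) *: (row j Y - row l X).
  by apply/rowP => k; rewrite !mxE; ring.
have := dot_comb_le (ltW t1_gt0) (distXY i j) (distXY l j).
by rewrite exprMn (addrC 1) subrK.
Qed.

Lemma conv_hull_diam u v : conv_hull X u -> conv_hull X v ->
  dot (u - v) (u - v) <= (2 * D) ^+ 2.
Proof.
move=> uX vX; have [j _] := row_index.
rewrite -[v]scale1r; apply: conv_hull_dist_le vX _ => l; rewrite scale1r.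
rewrite -opprB dotNl dotNr opprK -[u]scale1r.
apply: conv_hull_dist_le uX _ => m; rewrite scale1r.
have -> : row l X - row m X = (row j Y - row m X) + (-1) *: (row j Y - row l X).
  by apply/rowP => k; rewrite !mxE; ring.
have -> : (-1) *: (row j Y - row l X) = 1 *: (- (row j Y - row l X)).
  by rewrite scaleN1r scale1r.
rewrite exprMn; apply: (dot_comb_le ler01 (distXY m j)).
by rewrite dotNl dotNr opprK.
Qed.

(** The gradient step moves [z_j] towards [t y_j - (t-1) x], where [x] is the
    mean of the points of [X] for the conditional law given by the Gibbs
    weights. *)
Lemma grad_Z_potential_step x j : exists2 u, conv_hull X u &
  grad_Z (potential_step P x) j = (b j / (t * (t - 1))) *:
    (row j (potential_step P x).2 - (t *: row j Y - (t - 1) *: u)).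
Proof.
set y := potential_step P x.
exists (\sum_i (a i * expR (logit y i j)) *: row i X).
  exists (fun i => a i * expR (logit y i j)); split=> // [i|].
    by rewrite mulr_ge0 ?expR_ge0// ltW.
  exact: potential_step_marginal.
have -> : grad_Z y j = (b j / (t - 1)) *: (row j y.2 - row j Y) - (b j / t) *:
    \sum_i (a i * expR (logit y i j)) *: (row j y.2 - row i X).
  congr (_ - _); rewrite scaler_sumr; apply: eq_bigr => i _.
  by rewrite scalerA; congr (_ *: _); ring.
under eq_bigr do rewrite scalerBr.
rewrite sumrB -scaler_suml potential_step_marginal scale1r.
move: (\sum_i _) => S; apply/rowP => k; rewrite !mxE.
by field; rewrite t_neq0 t1_neq0.
Qed.

Lemma potential_step2 x : (potential_step P x).2 = x.2.
Proof. by rewrite potential_stepE. Qed.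

Lemma extrapolated_full_step tau x j : 0 <= tau -> tau * beta <= t * (t - 1) ->
  extrapolated x.2 j ->
  extrapolated (full_step P tau x).2 j.
Proof.
move=> tau0 taub [u uX xE]; rewrite full_stepE /extrapolated row_Z_step.
have [v vX ->] := grad_Z_potential_step x j.
rewrite potential_step2 xE.
pose th := tau * b j / (t * (t - 1)).
have th01 : 0 <= th <= 1.
  have tt0 : 0 < t * (t - 1) by rewrite mulr_gt0.
  apply/andP; split; first by rewrite divr_ge0 ?mulr_ge0// ltW.
  by rewrite ler_pdivrMr// mul1r (le_trans _ taub)// ler_wpM2l.
exists ((1 - th) *: u + th *: v); first exact: conv_hull_convex.
apply/rowP => k; rewrite !mxE /th; field.
by rewrite t_neq0 t1_neq0.
Qed.

(** During a step [z_j] moves by at most [2 beta D tau / t] at distance at most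
    [t D] from [x_i], so the exponents grow by at most
    [2 beta D^2 tau / (t eps)].  This is why the step size has to be at most a
    constant times [eps]. *)
Lemma logit_full_step tau x i j : 0 <= tau -> 2 * D ^+ 2 * (tau * beta) <= t * eps ->
  extrapolated x.2 j ->
  logit (full_step P tau x) i j <= logit (potential_step P x) i j + 1.
Proof.
move=> tau0 taub zx; rewrite -lerBlDl -(ler_pM2l eps_gt0) mulr1 logitB full_stepE.
rewrite /= !subrr add0r sub0r.
set dz := row j _; set e := row j _ - row i X.
have [v vX gE] := grad_Z_potential_step x j.
have [u uX xE] := zx.
have dzE : dz = (- (tau * b j / t)) *: (v - u).
  have -> : dz = - (tau *: grad_Z (potential_step P x) j).
    have -> : dz = row j (Z_step P tau (potential_step P x).1.1
        (potential_step P x).1.2 (potential_step P x).2)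
        - row j (potential_step P x).2 by apply/rowP => k; rewrite !mxE.
    by rewrite row_Z_step addrAC subrr add0r.
  rewrite gE potential_step2 xE; apply/rowP => k; rewrite !mxE; field.
  by rewrite t_neq0 t1_neq0.
have e2 : dot e e <= (t * D) ^+ 2.
  by rewrite /e potential_step2; exact: extrapolated_dist.
have tb0 : 0 <= tau * b j / t by rewrite divr_ge0 ?mulr_ge0// ltW.
have tD0 : 0 <= t * D by rewrite mulr_ge0// ltW.
have edz : `|dot e (v - u)| <= t * D * (2 * D).
  have : dot e (v - u) ^+ 2 <= (t * D * (2 * D)) ^+ 2.
    rewrite [leRHS]exprMn; apply: le_trans (dot_cauchy_schwarz _ _) _.
    by apply: ler_pM; rewrite ?dot_ge0//; exact: conv_hull_diam.
  rewrite -[X in X <= _]real_normK ?num_real// ler_sqr ?nnegrE//.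
  by rewrite mulr_ge0// mulr_ge0.
apply: (@le_trans _ _ (- (t^-1 * dot e dz))).
  by rewrite gerDr oppr_le0 mulr_ge0 ?dot_ge0// invr_ge0 mulr_ge0// ltW.
rewrite dzE dotZr mulNr mulrN opprK.
apply: (@le_trans _ _ (t^-1 * (tau * b j / t * (t * D * (2 * D))))).
  rewrite ler_pM2l ?invr_gt0//; apply: ler_wpM2l => //.
  by apply: le_trans edz; exact: ler_norm.
have -> : t^-1 * (tau * b j / t * (t * D * (2 * D))) =
    t^-1 * (2 * D ^+ 2 * (tau * b j)) by field; rewrite t_neq0.
rewrite ler_pdivrMl//; apply: le_trans taub.
by rewrite ler_wpM2l ?mulr_ge0 ?sqr_ge0// ler_wpM2l.
Qed.

(** The Gibbs weights at the end of the step are at most [expR 1] times those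
    before it, and the latter average to one over [i]. *)
Lemma hess_form_full_step_le tau x h : 0 <= tau -> tau * beta <= t * (t - 1) ->
  2 * D ^+ 2 * (tau * beta) <= t * eps -> (forall j, extrapolated x.2 j) ->
  enorm h = 1 ->
  hess_form (full_step P tau x) h h <= beta * ((t - 1)^-1 + expR 1 * D ^+ 2 / eps).
Proof.
move=> tau0 taub1 taub2 xX h1; set y := potential_step P x.
have yX j := extrapolated_full_step tau0 taub1 (xX j).
set C := (t - 1)^-1 + _.
have C0 : 0 <= C.
  rewrite addr_ge0 ?invr_ge0 ?(ltW t1_gt0)// divr_ge0 ?(ltW eps_gt0)//.
  by rewrite mulr_ge0 ?expR_ge0 ?sqr_ge0.
apply: (@le_trans _ _ (avg (fun i j => ((t - 1)^-1
    + expR (logit y i j) * (expR 1 * D ^+ 2 / eps)) * dot (row j h) (row j h)))).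
  apply: le_avg => i j; rewrite mulrDl lerD2l.
  set E := expR (logit (full_step P tau x) i j).
  set u := row j (full_step P tau x).2 - row i X.
  have E0 : 0 < E by exact: expR_gt0.
  have EE : E <= expR (logit y i j) * expR 1.
    by rewrite -expRD ler_expR; exact: logit_full_step.
  apply: (@le_trans _ _ (E / t * ((t * eps)^-1 * (dot u (row j h) ^+ 2)))).
    apply: ler_wpM2l; first by rewrite divr_ge0 ?ltW.
    by rewrite expr2 mulrA gerBl dot_ge0.
  apply: (@le_trans _ _ (E * (D ^+ 2 / eps * dot (row j h) (row j h)))); last first.
    have -> : expR (logit y i j) * (expR 1 * D ^+ 2 / eps) * dot (row j h) (row j h)
      = expR (logit y i j) * expR 1 * (D ^+ 2 / eps * dot (row j h) (row j h)) by ring.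
    by apply: ler_wpM2r => //; rewrite mulr_ge0 ?dot_ge0// divr_ge0 ?sqr_ge0// ltW.
  have -> : E * (D ^+ 2 / eps * dot (row j h) (row j h)) =
      E / t * ((t * eps)^-1 * ((t * D) ^+ 2 * dot (row j h) (row j h))).
    by field; rewrite t_neq0 eps_neq0.
  apply: ler_wpM2l; first by rewrite divr_ge0 ?ltW.
  apply: ler_wpM2l; first by rewrite invr_ge0 mulr_ge0// ltW.
  apply: le_trans (dot_cauchy_schwarz _ _) _.
  by rewrite ler_wpM2r ?dot_ge0//; exact: extrapolated_dist.
rewrite /avg exchange_big/=.
apply: (@le_trans _ _ (\sum_j beta * C * dot (row j h) (row j h))); last first.
  by rewrite -mulr_sumr -enorm_sq_rows h1 expr1n mulr1.
apply: ler_sum => j _.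
have -> : \sum_i a i * b j * (((t - 1)^-1 + expR (logit y i j)
     * (expR 1 * D ^+ 2 / eps)) * dot (row j h) (row j h)) =
    (b j * C) * dot (row j h) (row j h).
  move: (dot (row j h) (row j h)) => v.
  transitivity (b j * v * ((t - 1)^-1 * \sum_i a i
    + (expR 1 * D ^+ 2 / eps) * \sum_i a i * expR (logit y i j))).
    rewrite !mulr_sumr -big_split/= mulr_sumr.
    by apply: eq_bigr => i _; ring.
  by rewrite a_sum potential_step_marginal /C; ring.
by rewrite ler_wpM2r ?dot_ge0// ler_wpM2r.
Qed.

(** The negative part of the Hessian is at most [1/t] in mean, since the Gibbs
    weights average to one over [i], against the [1/(t-1)] of the quadratic
    penalty.  The positivity of [LZ] follows, without which its inverse would
    not bound step sizes from above. *)
Lemma hess_form_potential_step_gt0 x h : enorm h = 1 ->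
  0 < hess_form (potential_step P x) h h.
Proof.
move=> h1; set y := potential_step P x.
pose k := (t - 1)^-1 - t^-1.
have k0 : 0 < k by rewrite subr_gt0 ltf_pV2 ?posrE// ltrBlDr ltrDl.
apply: (@lt_le_trans _ _ (avg (fun i j =>
    ((t - 1)^-1 - expR (logit y i j) / t) * dot (row j h) (row j h)))); last first.
  apply: le_avg => i j; rewrite mulrBl mulrBr lerD2l lerDr.
  apply: mulr_ge0; first by rewrite divr_ge0 ?expR_ge0// ltW.
  rewrite -mulrA -expr2; apply: mulr_ge0; last exact: sqr_ge0.
  by rewrite invr_ge0 mulr_ge0// ltW.
have -> : avg (fun i j =>
    ((t - 1)^-1 - expR (logit y i j) / t) * dot (row j h) (row j h)) =
    k * \sum_j b j * dot (row j h) (row j h).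
  rewrite /avg exchange_big mulr_sumr/=; apply: eq_bigr => j _.
  move: (dot (row j h) (row j h)) => v.
  transitivity (b j * v * ((t - 1)^-1 * \sum_i a i
    - t^-1 * \sum_i a i * expR (logit y i j))).
    rewrite !mulr_sumr -sumrB mulr_sumr.
    by apply: eq_bigr => i _; ring.
  by rewrite a_sum potential_step_marginal /k; ring.
rewrite mulr_gt0// lt_def sumr_ge0 ?andbT; last first.
  by move=> j _; rewrite mulr_ge0 ?dot_ge0// ltW.
apply/negP; rewrite psumr_eq0; last by move=> j _; rewrite mulr_ge0 ?dot_ge0// ltW.
move=> /allP z; have := enorm_sq_rows h; rewrite h1 expr1n big1 => [|j _].
  by move/eqP; rewrite oner_eq0.
by have := z j (mem_index_enum _); rewrite /= mulf_eq0 (gt_eqF (b_gt0 j)) => /eqP.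
Qed.

(** The state at parameter [s] of the segment has the form of a full step, which
    lets the estimates for full steps cover the whole segment. *)
Lemma segment_full_step tau s x :
  (1 - s) *: potential_step P x + s *: full_step P tau x = full_step P (s * tau) x.
Proof.
rewrite !full_stepE; set y := potential_step P x.
case: y => [[phi psi] Z]; congr (_, _, _).
- by rewrite -scalerDl subrK scale1r.
- by rewrite -scalerDl subrK scale1r.
- apply/row_matrixP => j; rewrite linearD !linearZ/=.
  rewrite !(row_Z_step _ (phi, psi, Z)) /=.
  by apply/rowP => k; rewrite !mxE; ring.
Qed.

Lemma step_le_invLZ tau x0 : (0 < d)%N -> 0 < tau -> tau * beta <= t * (t - 1) ->
  2 * D ^+ 2 * (tau * beta) <= t * eps ->
  tau * (beta * ((t - 1)^-1 + expR 1 * D ^+ 2 / eps)) <= 1 ->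
  (forall j, extrapolated x0.2 j) -> (tau%:E <= (LZ P tau x0)^-1)%E.
Proof.
move=> d0 tau0 taub1 taub2 taub3 x0X.
have beta0 : 0 < beta by have [j _] := row_index; exact: lt_le_trans (b_le j).
have xX n j : extrapolated (iterate P tau x0 n).2 j.
  by elim: n => // n IH; apply: extrapolated_full_step => //; exact: ltW.
have ub : (LZ P tau x0 <= (tau^-1)%:E)%E.
  apply: ge_ereal_sup => _ [n [s [h [/andP[s0 s1] h1 ->]]]].
  rewrite lee_fin iterateS segment_full_step hessZ_quadE.
  have stau0 : 0 <= s * tau by rewrite mulr_ge0// ltW.
  have stau : s * tau <= tau by rewrite ler_piMl// ltW.
  apply: le_trans (hess_form_full_step_le stau0 _ _ (xX n) h1) _.
  - by apply: le_trans taub1; rewrite ler_wpM2r// ltW.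
  - apply: le_trans taub2; rewrite ler_wpM2l ?mulr_ge0 ?sqr_ge0//.
    by rewrite ler_wpM2r// ltW.
  - by rewrite -[leRHS]mulr1 ler_pdivlMl.
have lb : (0 < LZ P tau x0)%E.
  have [j _] := row_index; pose h : 'M[R]_(N, d) := delta_mx j (Ordinal d0).
  have h1 : enorm h = 1.
    rewrite /enorm (bigD1 j)//= (bigD1 (Ordinal d0))//= !big1.
    - by rewrite mxE !eqxx expr1n !addr0 sqrtr1.
    - move=> k kj; apply: big1 => l _; rewrite mxE (negbTE kj) expr0n//.
    - by move=> l lk; rewrite mxE (negbTE lk) andbF expr0n.
  apply: (@lt_le_trans _ _ (hess_form (potential_step P x0) h h)%:E).
    by rewrite lte_fin; exact: hess_form_potential_step_gt0.
  apply: ereal_sup_ubound; exists 0%N, 0, h; split=> //.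
    by rewrite lexx ler01.
  by rewrite hessZ_quadE subr0 scale1r scale0r addr0.
move: ub lb; case: (LZ P tau x0) => [r| |] //.
rewrite lee_fin lte_fin => rt r0; rewrite inver gt_eqF// lee_fin.
by rewrite -[tau]invrK lef_pV2 ?posrE ?invr_gt0.
Qed.

End Curvature.

End Objective.

(** * The step size and the rate *)

Lemma assumptions_regular (R : realType) d M N (P : problem R d M N) x0 :
  assumptions P x0 -> regular_problem P.
Proof. by move=> [[_ t1 /andP[e0 _]] [[a0 b0 a1 b1] _]]. Qed.

Lemma wb_le_bmax (R : realType) d M N (P : problem R d M N) j : wb P j <= bmax P.
Proof. exact: le_bigmax. Qed.

Lemma diam_ge0 (R : realType) d M N (P : problem R d M N) : 0 <= diam P.
Proof. exact: bigmax_ge_id. Qed.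

Lemma dist_le_diam (R : realType) d M N (P : problem R d M N) i j :
  dot (row j (ptY P) - row i (ptX P)) (row j (ptY P) - row i (ptX P))
    <= diam P ^+ 2.
Proof.
have -> : row j (ptY P) - row i (ptX P) = - (row i (ptX P) - row j (ptY P)).
  by rewrite opprB.
rewrite dotNl dotNr opprK -enorm_sq ler_sqr ?nnegrE ?sqrtr_ge0 ?diam_ge0//.
rewrite /diam; apply: le_trans (le_bigmax _ _ i).
exact: (le_bigmax _ (fun j => enorm (row i (ptX P) - row j (ptY P)))).
Qed.

(** The inverse of a sum whose terms take care of one requirement on the step
    size each: staying in the extrapolated hulls, keeping the Gibbs weights
    comparable along a step, and the curvature bound. *)
Definition step_constant (R : realType) (t beta D : R) : R :=
  (beta * ((t * (t - 1))^-1 + 2 * D ^+ 2 / t + ((t - 1)^-1 + expR 1 * D ^+ 2)))^-1.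

Lemma step_constant_admissible (R : realType) (t beta D : R) :
  1 < t -> 0 < beta -> admissible t beta D (step_constant t beta D).
Proof.
move=> t1 beta0.
have t0 : 0 < t by lra.
have t10 : 0 < t - 1 by lra.
set u := (t * (t - 1))^-1; set v := 2 * D ^+ 2 / t.
set w := (t - 1)^-1 + expR 1 * D ^+ 2.
have u0 : 0 < u by rewrite invr_gt0 mulr_gt0.
have v0 : 0 <= v by rewrite divr_ge0 ?(ltW t0)// mulr_ge0 ?sqr_ge0.
have w0 : 0 <= w by rewrite addr_ge0 ?invr_ge0 ?(ltW t10)// mulr_ge0 ?expR_ge0 ?sqr_ge0.
have S0 : 0 < beta * (u + v + w) by rewrite mulr_gt0//; lra.
split; first by rewrite invr_gt0.
move=> d M N P x0 tau tE bE DE ass /andP[tau0 tauK].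
have regP := assumptions_regular ass.
have [[d0 _ /andP[e0 e1]] [_ [_ x0X]]] := ass.
have tau_small : tau * beta * (u + v + w) <= eps P.
  by rewrite -mulrA -ler_pdivlMr// mulrC.
have tb0 : 0 < tau * beta by rewrite mulr_gt0.
have hu : tau * beta * u <= eps P by nra.
have hv : tau * beta * v <= eps P by nra.
have hw : tau * beta * w <= eps P by nra.
have taub1 : tau * beta <= t * (t - 1).
  rewrite -[leRHS]mul1r -ler_pdivrMr ?mulr_gt0//.
  exact: le_trans hu e1.
rewrite le_min bE; apply/andP; split.
  by rewrite lee_fin ler_pdivlMr// tE.
apply: (@step_le_invLZ _ _ _ _ P regP D beta) => //; rewrite ?tE//.
- by rewrite -DE; exact: diam_ge0.
- by rewrite -DE; exact: dist_le_diam.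
- by rewrite -bE; exact: wb_le_bmax.
- have -> : 2 * D ^+ 2 * (tau * beta) = t * (tau * beta * v).
    by rewrite /v; field; rewrite gt_eqF.
  by rewrite ler_pM2l.
- apply: (@le_trans _ _ (tau * beta * w / eps P)); last first.
    by rewrite ler_pdivrMr// mul1r.
  rewrite mulrA -[leRHS]mulrA ler_pM2l// /w mulrDl lerD2r.
  by rewrite ler_pdivlMr// ler_piMr ?invr_ge0 ?(ltW t10).
Qed.

Theorem proposition6p5 (R : realType) (t beta D : R) (ht : 1 < t) :
  (exists K : R, admissible t beta D K) /\
  (forall K : R, admissible t beta D K ->
   forall (d M N : nat) (P : problem R d M N) (x0 : state R d M N) (tau : R),
     tt_ P = t -> bmax P = beta -> diam P = D -> assumptions P x0 ->
     0 < tau <= K * eps P ->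
     exists2 xstar : state R d M N, unique (is_solution P) xstar &
     exists2 eta : R, 0 < eta < 1 &
       forall n : nat,
         objective P (iterate P tau x0 n.+1) - objective P xstar
           <= eta * (objective P (iterate P tau x0 n) - objective P xstar)).
Proof.
split.
  have [beta0|beta0] := ltP 0 beta.
    by exists (step_constant t beta D); exact: step_constant_admissible.
  (* No problem has [bmax P <= 0]. *)
  exists 1; split=> // d M N P x0 tau _ bE _ ass.
  have regP := assumptions_regular ass.
  have [j _] := row_index regP; have [_ _ [_ b0] _ _] := regP.
  by have := lt_le_trans (b0 j) (wb_le_bmax P j); rewrite bE ltNge beta0.
move=> K [K0 Kadm] d M N P x0 tau tE bE DE ass tauK.
have regP := assumptions_regular ass.
have tau0 : 0 < tau by case/andP: tauK.
have := Kadm _ _ _ _ _ _ tE bE DE ass tauK.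
rewrite le_min => /andP[_ tauL].
have [xs xsP] := exists_solution regP.
exists xs; first by split=> // y yP; exact: (unique_solution regP).
apply: (linear_rate regP tau0 _ xsP (curvature_bounded_of_LZ tau0 tauL)).
by case: ass => _ [_ []].
Qed.
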